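(* Let $\beta>1$ and let $\Pi$, $T$ be as in the context. (i) If $\beta<2$, then almost surely there exists an infinite geodesic path $(\varnothing=x_0,x_1,\ldots)$ in $\mathbb{T}$ with $\sum_{n\geq1}T(x_{n-1},x_n)<\infty$. (ii) If $\beta>2$, then almost surely every infinite geodesic path $(\varnothing=x_0,x_1,\ldots)$ in $\mathbb{T}$ satisfies $\sum_{n\geq1}T(x_{n-1},x_n)=\infty$.
   Context: $\mathbb{T}$ is the $3$-regular tree with graph distance $d$ and root $\varnothing$. A line is the vertex set $\{x_n:n\in\mathbb{Z}\}$ of a bi-infinite geodesic path. $\mathbb{L}$ is the set of lines, with the Borel structure generated by the sets $\langle x,y\rangle$ of lines passing through both $x$ and $y$ ($x\neq y$ vertices). $\mu$ is the unique Borel measure on $\mathbb{L}$ invariant under graph automorphisms with $\mu\langle x,y\rangle=2^{-d(x,y)}$ for all $x\neq y$. $\Pi$ is a Poisson process on $\mathbb{L}\times(0,\infty)$ with intensity $\nu=(\beta-1)\,\mu\otimes v^{-\beta}\,\mathrm{d}v$. Each atom $(\ell,v)$ is called a road with line $\ell$ and speed $v$. For an edge $e$ of $\mathbb{T}$, $V_e$ is the largest speed of a road of $\Pi$ whose line contains both endpoints of $e$. For vertices $x,y$, $T(x,y)=\sum_{i=1}^n V_{e_i}^{-1}$, where $e_1,\dots,e_n$ are the edges of the geodesic from $x$ to $y$ (this is the driving distance). *)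

(* Defs.v *)
From HB Require Import structures.
From mathcomp Require Import all_boot all_order all_algebra.
From mathcomp Require Import all_classical all_reals all_analysis.
From mathcomp Require Import zify.

Set Implicit Arguments.
Unset Strict Implicit.
Unset Printing Implicit Defensive.

Import Order.TTheory GRing.Theory Num.Theory.
Local Open Scope classical_set_scope.
Local Open Scope ring_scope.

(** * The 3-regular tree.
    Vertices are reduced words over {0,1,2} (no two consecutive equal letters),
    i.e. the Cayley graph of Z/2 * Z/2 * Z/2.  The root is the empty word;
    w is adjacent to w ++ [:: c] for every letter c different from the last
    letter of w.  Every vertex then has exactly 3 neighbours. *)
Definition vert := seq 'I_3.
Definition root : vert := [::].
Definition reduced (w : vert) : bool := sorted (fun a b : 'I_3 => a != b) w.

Fixpoint lcp (s t : vert) : nat :=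
  match s, t with
  | a :: s', b :: t' => if a == b then (lcp s' t').+1 else 0%N
  | _, _ => 0%N
  end.

Definition dist (x y : vert) : nat := (size x + size y - 2 * lcp x y)%N.

Definition biinf_geodesic (x : int -> vert) : Prop :=
  (forall n, reduced (x n)) /\
  (forall m n : int, dist (x m) (x n) = `|m - n|%N).

Definition is_line (L : set vert) : Prop :=
  exists x : int -> vert, biinf_geodesic x /\ L = range x.

Definition root_geodesic (x : nat -> vert) : Prop :=
  x 0%N = root /\ (forall n, reduced (x n)) /\
  (forall m n : nat, dist (x m) (x n) = (maxn m n - minn m n)%N).

(** An explicit line, used only to show that the type of lines is nonempty. *)
Fixpoint alt (c : bool) (n : nat) : vert :=
  match n with
  | 0 => [::]
  | n'.+1 => (if c then inord 1 else inord 0) :: alt (~~ c) n'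
  end.

Lemma size_alt c n : size (alt c n) = n.
Proof. by elim: n c => //= n IH c; rewrite IH. Qed.

Lemma lcp_alt_same c a b : lcp (alt c a) (alt c b) = minn a b.
Proof.
elim: a c b => [|a IH] c [|b] //=; first by rewrite eqxx IH minnSS.
Qed.

Lemma inord01 : (inord 1 : 'I_3) != inord 0.
Proof. by apply/eqP => /(congr1 val); rewrite /= !inordK. Qed.

Lemma lcp_alt_diff a b : lcp (alt true a) (alt false b) = 0%N.
Proof. by case: a => [|a]; case: b => [|b] //=; rewrite (negbTE inord01). Qed.

Lemma lcp_sym s t : lcp s t = lcp t s.
Proof.
elim: s t => [|a s IH] [|b t] //=; rewrite eq_sym; case: eqP => // _.
by rewrite IH.
Qed.

Lemma reduced_alt c n : reduced (alt c n).
Proof.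
elim: n c => [|n IH] c //=; case: n IH => [|n] IH //=.
rewrite /reduced /= in IH *; rewrite (IH (~~ c)) andbT.
by case: c => /=; [|rewrite eq_sym]; exact: inord01.
Qed.

Definition alt_line (n : int) : vert :=
  match n with Posz k => alt false k | Negz k => alt true k.+1 end.

Lemma alt_line_geo : biinf_geodesic alt_line.
Proof.
split=> [[n|n]|]; first exact: reduced_alt; first exact: reduced_alt.
move=> [m|m] [n|n]; rewrite /dist /alt_line !size_alt;
  rewrite ?lcp_alt_same ?lcp_alt_diff ?[lcp (alt false _) _]lcp_sym ?lcp_alt_diff ?NegzE.
all: lia.
Qed.

Record line := Line { lset :> set vert; lineP : is_line lset }.

HB.instance Definition _ := gen_eqMixin line.
HB.instance Definition _ := gen_choiceMixin line.
HB.instance Definition _ := isPointed.Build line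
  (Line (ex_intro _ alt_line (conj alt_line_geo erefl))).

Definition thru (x y : vert) : set line := [set L : line | lset L x /\ lset L y].

Definition line_gen : set (set line) :=
  [set A | exists x y : vert, x <> y /\ A = thru x y].

Definition lineM := g_sigma_algebraType line_gen.

Section roads.
Local Open Scope ereal_scope.
Context {R : realType}.

Definition speed_density (beta : R) : set R -> \bar R :=
  fun A => \int[lebesgue_measure]_(v in A `&` `]0%R, +oo[%classic : set R)
             ((v `^ (- beta))%R)%:E.

Definition intensity (beta : R) (mu : set lineM -> \bar R)
  : set (lineM * R) -> \bar R :=
  fun A => (beta - 1)%:E * (mu \x speed_density beta) A.

Definition ncount (o : option nat) : \bar R :=
  if o is Some k then (k%:R)%:E else +oo.

Definition npoints {Omega : Type} {X : choiceType} (Pi : Omega -> set X) (w : Omega) (A : set X)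
  : \bar R := \esum_(p in Pi w `&` A) 1.

Definition poisson_process {d dX} {Omega : measurableType d} {X : measurableType dX}
  (P : probability Omega R) (Pi : Omega -> set X) (nu : set X -> \bar R) : Prop :=
  [/\ (forall A, measurable A -> forall o,
         measurable [set w | npoints Pi w A = ncount o]),
      (forall A, measurable A -> nu A < +oo -> forall k : nat,
         P [set w | npoints Pi w A = ncount (Some k)] =
           ((expR (- fine (nu A)) * fine (nu A) ^+ k / (k`!)%:R)%R)%:E),
      (forall A, measurable A -> nu A = +oo ->
         P [set w | npoints Pi w A = +oo] = 1) &
      (forall (n : nat) (A : 'I_n -> set X), (forall i, measurable (A i)) ->
         (forall i j, i != j -> A i `&` A j = set0) ->
         forall o : 'I_n -> option nat,
         P (\bigcap_(i in [set: 'I_n]) [set w | npoints Pi w (A i) = ncount (o i)])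
         = \prod_(i < n) P [set w | npoints Pi w (A i) = ncount (o i)])].

Context {Omega : Type} (Pi : Omega -> set (line * R)).

(** V_e for the edge e = {u, w}: the largest speed of a road whose line
    contains both endpoints (supremum in \bar R; it is a.s. attained) *)
Definition speed (om : Omega) (u w : vert) : \bar R :=
  ereal_sup [set v%:E | v in [set v : R | exists L : line,
                             Pi om (L, v) /\ lset L u /\ lset L w]].

(** V_e^{-1}, with the conventions 1/(+oo) = 0 and 1/V = +oo when there is no
    road through e (these cases have probability 0). *)
Definition edge_time (om : Omega) (u w : vert) : \bar R :=
  match speed om u w with
  | r%:E => if (0 < r)%R then (r^-1)%:E else +oo
  | +oo => 0
  | -oo => +oo
  end.

(** driving distance T(x,y): sum of V_e^{-1} over the edges of the geodesic
    from x to y (x -> common ancestor -> y) *)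
Definition drive (om : Omega) (x y : vert) : \bar R :=
  let k := lcp x y in
  (\sum_(k <= i < size x) edge_time om (take i x) (take i.+1 x)) +
  (\sum_(k <= i < size y) edge_time om (take i y) (take i.+1 y)).

End roads.

(* Main.v *)
Require Import Defs.
From HB Require Import structures.
From mathcomp Require Import all_boot all_order all_algebra.
From mathcomp Require Import all_classical all_reals all_analysis.
From mathcomp Require Import measurable_realfun finmap zify ring lra.

(* A road of speed at least 2^k is said to have level k.  Roads of speed at least
   s pass through an edge at rate s^(1-beta) / 2, and turn at a vertex z (that is,
   pass through both children of z) at rate s^(1-beta) / 4, independently of all
   roads that leave the subtree of z.

   beta > 2.  Let S(y) be the sum of 2^k over all k >= 0 and all roads of speed
   at least 2^k through the edge above y.  A road through that edge continues to
   exactly one child, so S(y0) + S(y1) = S(y) + 2 N(y), where N(y) only counts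
   roads turning at y; it is independent of the edges above and has a finite mean
   (here beta > 2 is needed).  Discounting each edge by a factor
   exp(- const / speed) compensates the new roads, so that the expected discounted
   sum of S over the descendants of y at distance n stays bounded in n.  A path
   of finite driving time would make this sum tend to infinity, since its total
   discount is positive and its speeds tend to infinity.

   beta < 2.  Follow a road of level k until a road of level k + 1 turns at the
   current vertex, and switch to it.  Among b^k vertices with
   2^(beta-1) < b < 2 such a turn is missing with probability O((2^(beta-1)/b)^k),
   and b^k edges at speed 2^k take time (b/2)^k; both are summable. *)

Set Implicit Arguments.
Unset Strict Implicit.
Unset Printing Implicit Defensive.
Import Order.TTheory GRing.Theory Num.Theory.
Import numFieldNormedType.Exports.
Local Open Scope classical_set_scope.
Local Open Scope ring_scope.

(** * Lines in the tree *)

(** [lift] skips the last letter of [y], which keeps the word reduced. At the root the default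
    [ord0] is skipped, so that [child] lists only two of its three neighbours. *)
Definition child (y : vert) (i : 'I_2) : vert := rcons y (lift (last ord0 y) i).

Definition parent (y : vert) : vert := take (size y).-1 y.

Lemma parent_rcons y c : parent (rcons y c) = y.
Proof. by rewrite /parent size_rcons -cats1 take_size_cat. Qed.

Lemma reduced_rcons y c : reduced y -> c != last ord0 y -> reduced (rcons y c).
Proof.
by case: y => //= a y ry cy; rewrite /reduced /= rcons_path ry eq_sym.
Qed.

Lemma reduced_rcons_last y c : y <> [::] -> reduced (rcons y c) ->
  c != last ord0 y.
Proof.
by case: y => //= a y _; rewrite /reduced /= rcons_path eq_sym => /andP[].
Qed.

Lemma reduced_child y i : reduced y -> reduced (child y i).
Proof. by move=> ry; apply: reduced_rcons => //; rewrite eq_sym neq_lift. Qed.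

Lemma rcons_child y c : y <> [::] -> reduced (rcons y c) ->
  exists i, rcons y c = child y i.
Proof.
move=> y0 /(reduced_rcons_last y0) cy; rewrite /child.
have [j ej|ej] := unliftP (last ord0 y) c; first by exists j; rewrite -ej.
by rewrite ej eqxx in cy.
Qed.

Lemma child_inj y : injective (child y).
Proof. by move=> i j e; apply: (@lift_inj _ (last ord0 y)); exact: rcons_injr e. Qed.

Lemma lcp_le_size (s t : vert) : (lcp s t <= size s)%N.
Proof. by elim: s t => [|a s IH] [|b t] //=; case: eqP => //= _; apply: IH. Qed.

Lemma take_lcp (s t : vert) : take (lcp s t) s = take (lcp s t) t.
Proof. by elim: s t => [|a s IH] [|b t] //=; case: eqP => //= ->; rewrite IH. Qed.

Lemma lcp_size (s t : vert) : lcp s t = size s -> prefix s t.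
Proof.
by move=> e; have := take_lcp s t; rewrite e take_size prefixE => <-.
Qed.

Lemma lcp_prefix (s t : vert) : prefix s t -> lcp s t = size s.
Proof.
move=> /prefixP[u ->]; elim: s => [|a s IH] /=; first by case: u.
by rewrite eqxx IH.
Qed.

Lemma dist_prefix (s t : vert) : prefix s t -> dist s t = (size t - size s)%N.
Proof.
by move=> st; rewrite /dist lcp_prefix// mul2n -addnn subnDl.
Qed.

Lemma distC (s t : vert) : dist s t = dist t s.
Proof. by rewrite /dist lcp_sym addnC. Qed.

Lemma dist_child y i j : i != j -> dist (child y i) (child y j) = 2%N.
Proof.
move=> ij; rewrite /dist !size_rcons.
suff -> : lcp (child y i) (child y j) = size y by lia.
rewrite /child; have := neq_lift; move: (last _ _) => l _.
elim: y => [|a y IH] /=; last by rewrite eqxx IH.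
by rewrite (inj_eq (@lift_inj _ l)) (negbTE ij).
Qed.

Lemma reduced_neighbor z v : z <> [::] -> reduced v -> dist z v = 1%N ->
  v = parent z \/ exists i, v = child z i.
Proof.
move=> z0 rv; rewrite /dist => d1.
have lz := lcp_le_size z v; have := lcp_le_size v z; rewrite lcp_sym => lv.
have [sv|sv] := leqP (size v) (size z).
  left; have e : lcp z v = size v by lia.
  have := take_lcp z v; rewrite e take_size => <-; rewrite /parent.
  by congr take; lia.
right; have e : lcp z v = size z by lia.
have sv1 : size v = (size z).+1 by lia.
have /prefixP[u ev] := lcp_size e; move: rv sv1; rewrite ev size_cat.
case: u {ev} => [|c [|c' u]] /=; try lia.
by rewrite cats1 => rv _; apply: rcons_child.
Qed.

Section line_geometry.
Variable L : line.

Lemma line_neighbors z : lset L z -> exists v w, [/\ v <> w, reduced v, reduced w &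
  [/\ lset L v, lset L w, dist z v = 1%N, dist z w = 1%N &
  forall u, lset L u -> dist z u = 1%N -> u = v \/ u = w]].
Proof.
case: L => S /= [x [[rx dx] ->]] [n _ <-].
exists (x (n + 1)), (x (n - 1)); split; rewrite ?rx//.
  by move=> e; have := dx (n + 1) (n - 1); rewrite e dist_prefix ?prefix_refl//; lia.
split; rewrite ?dx; try lia.
- by exists (n + 1).
- by exists (n - 1).
- move=> _ [m _ <-]; rewrite dx => h.
  have [->|->] : m = n + 1 \/ m = n - 1 by lia.
  + by left.
  + by right.
Qed.

(** Some index of the geodesic lies at the right distances from those of [u] and [w]; the two
    distances force its vertex to be the prefix of [w] of length [size v], which is [v]. *)
Lemma line_convex (u v w : vert) : lset L u -> lset L w -> prefix u v -> prefix v w -> lset L v.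
Proof.
case: L => S /= [x [[rx dx] ->]] [m _ um] [n _ wn] uv vw.
have uw := prefix_trans uv vw.
have := dx m n; rewrite um wn dist_prefix// => dmn.
have suv : (size u <= size v)%N := size_prefix uv.
have svw : (size v <= size w)%N := size_prefix vw.
have [k [dk dk']] : exists k : int, `|m - k|%N = (size v - size u)%N /\
    `|k - n|%N = (size w - size v)%N.
  have [mn|mn] := leP m n.
    by exists (m + (size v - size u)%N%:Z); lia.
  by exists (m - (size v - size u)%N%:Z); lia.
exists k => //.
move: dk dk'; rewrite -!dx um wn {1 2}/dist.
have l1 := lcp_le_size u (x k); have l2 := lcp_le_size (x k) w.
have := lcp_le_size (x k) u; have := lcp_le_size w (x k).
rewrite (lcp_sym (x k) u) (lcp_sym w) => l3 l4 d1 d2.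
have sk : size (x k) = size v by lia.
have /lcp_size : lcp (x k) w = size (x k) by lia.
rewrite prefixE sk => /eqP <-.
by move: vw; rewrite prefixE => /eqP.
Qed.

(** Two children are at distance 2, so the line has a vertex adjacent to both. Were it not [y], both
    children would be its parent and would coincide. *)
Lemma line_between y i j : i != j -> lset L (child y i) -> lset L (child y j) -> lset L y.
Proof.
move=> ij Li Lj; have dij := dist_child y ij; move: Li Lj dij.
case: L => S /= [x [[rx dx] ->]] [m _ xm] [n _ xn]; rewrite -{1}xm -{1}xn dx.
move=> dmn.
have [k [dk dk']] : exists k : int, `|m - k|%N = 1%N /\ `|k - n|%N = 1%N.
  have [mn|mn] := leP m n.
    by exists (m + 1); lia.
  by exists (m - 1); lia.
exists k => //.
have key i' m' : x m' = child y i' -> `|m' - k|%N = 1%N ->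
    x k = y \/ child y i' = parent (x k).
  move=> e; rewrite -dx e => d1.
  have := @reduced_neighbor (child y i') (x k).
  case=> //; first by rewrite /child; case: y {xm xn e d1}.
  - by rewrite /child parent_rcons; left.
  - by case=> j' ->; rewrite {2}/child parent_rcons; right.
have [//|e1] := key _ _ xm dk.
rewrite distnC in dk'; have [//|e2] := key _ _ xn dk'.
by move: ij; rewrite (child_inj (etrans e1 (esym e2))) eqxx.
Qed.

Lemma line_not_three y : y <> [::] -> lset L (parent y) -> lset L (child y ord0) ->
  lset L (child y ord_max) -> False.
Proof.
move=> y0 Lp L0 L1; have Ly : lset L y by exact: (@line_between y ord0 ord_max).
have [v [w [_ _ _ [_ _ _ _ h]]]] := line_neighbors Ly.
have dc i : dist y (child y i) = 1%N.
  by rewrite dist_prefix ?size_rcons ?subSnn// prefix_rcons.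
have dp : dist y (parent y) = 1%N.
  rewrite distC dist_prefix ?prefix_take// size_take.
  by case: y y0 {Lp L0 L1 Ly h dc} => //= a y _; rewrite ltnSn subSnn.
have n01 : child y ord0 <> child y ord_max by move=> /child_inj.
have np i : child y i <> parent y.
  move=> /(congr1 size); rewrite size_rcons size_take; case: ifP; lia.
have := np ord0; have := np ord_max.
by case: (h _ Lp dp) => ->; case: (h _ L0 (dc _)) => e0;
   case: (h _ L1 (dc _)) => e1; rewrite ?e0 ?e1// in n01 *.
Qed.

Lemma line_two_neighbors y : y <> [::] -> lset L y ->
  [\/ lset L (parent y) /\ lset L (child y ord0),
      lset L (parent y) /\ lset L (child y ord_max) |
      lset L (child y ord0) /\ lset L (child y ord_max)].
Proof.
move=> y0 /line_neighbors[v [w [vw rv rw [Lv Lw dv dw _]]]].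
have key u : reduced u -> lset L u -> dist y u = 1%N ->
    [\/ u = parent y, u = child y ord0 | u = child y ord_max].
  move=> ru Lu du; have [->|[i ->]] := reduced_neighbor y0 ru du.
    by constructor 1.
  case: i => [[|[|//]] p]; [constructor 2|constructor 3]; congr child;
    exact: val_inj.
have kv := key _ rv Lv dv; have kw := key _ rw Lw dw; move: Lv Lw vw.
by case: kv => ->; case: kw => -> Lv Lw //= _;
  [constructor 1|constructor 2|constructor 1|constructor 3|constructor 2|constructor 3].
Qed.

(** Convexity puts the parent of [z] on the line as well, so that three neighbours of [z] would lie
    on it. This is the geometric source of independence: no road turning at [z] meets a proper
    ancestor of [z]. *)
Lemma line_no_turn (u z : vert) i j : lset L u -> prefix u z -> u <> z -> i != j ->
  lset L (child z i) -> lset L (child z j) -> False.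
Proof.
move=> Lu uz nuz ij Li Lj; have Lz := line_between ij Li Lj.
have z0 : z <> [::] by move=> z0; move: uz nuz; rewrite z0; case: u {Lu}.
have Lp : lset L (parent z).
  apply: (line_convex Lu Lz); last exact: prefix_take.
  move: uz nuz => /prefixP[[|a t] ->] nuz; first by rewrite cats0 in nuz.
  by rewrite -[_ :: _]/(a :: t) lastI -rcons_cat parent_rcons prefix_prefix.
suff [L0 L1] : lset L (child z ord0) /\ lset L (child z ord_max) by exact: (line_not_three z0).
have h (k : 'I_2) : k = ord0 \/ k = ord_max.
  by case: k => [[|[|//]]] p; [left|right]; exact: val_inj.
by move: ij Li Lj; case: (h i) => ->; case: (h j) => ->.
Qed.

End line_geometry.

(** * Poisson processes *)

Local Open Scope ereal_scope.

Lemma sum_ereal1 {R : realType} {T : eqType} (s : seq T) :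
  \sum_(i <- s) (1 : \bar R) = (size s)%:R%:E.
Proof.
by rewrite sumEFin big_const_seq count_predT iter_addr_0.
Qed.

Section npoints.
Context {R : realType} {Omega : Type} {X : choiceType} (Pi : Omega -> set X).
Local Notation npts := (@npoints R Omega X Pi).

Lemma npoints_ge0 w A : 0 <= npts w A.
Proof. exact: esum_ge0. Qed.

Lemma npoints_ge w (B : {fset X}) A : [set` B] `<=` Pi w `&` A ->
  (#|` B|%:R)%:E <= npts w A.
Proof.
move=> BA; apply: esum_ge; exists [set` B] => //.
by rewrite fsbig_finite//= set_fsetK sum_ereal1.
Qed.

Lemma npoints_ncount w A : exists o, npts w A = ncount o.
Proof.
have [fA|iA] := pselect (finite_set (Pi w `&` A)).
  exists (Some #|` fset_set (Pi w `&` A)|).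
  by rewrite /npoints esum_fset// fsbig_finite//= sum_ereal1.
exists None; apply/eqyP => r r0.
have [B BA Bn] := infinite_set_fset (Num.truncn r).+1 iA.
apply: le_trans (npoints_ge BA); rewrite lee_fin.
apply: le_trans (ltW (truncnS_gt _)) _; by rewrite ler_nat.
Qed.

Lemma npoints_eq0 w A : npts w A = 0 <-> forall p, Pi w p -> ~ A p.
Proof.
split=> [n0 p Pp Ap|h]; last by rewrite /npoints esum1// => p [/h].
have := @npoints_ge w [fset p]%fset A; rewrite n0 cardfs1 lee_fin ler10 => h.
by have : false by apply: h => q /=; rewrite inE => /eqP ->.
Qed.

Lemma npoints_ge1 w A p : Pi w p -> A p -> 1 <= npts w A.
Proof.
move=> Pp Ap; have := @npoints_ge w [fset p]%fset A; rewrite cardfs1.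
by apply => q /=; rewrite inE => /eqP ->.
Qed.

Lemma npointsU w A B : A `&` B = set0 ->
  npts w (A `|` B) = npts w A + npts w B.
Proof.
move=> AB; rewrite /npoints (esumID A)//; congr (_ + _); congr esum.
  by rewrite -setIA setUK.
rewrite -setIA setIUl setICr set0U; congr (_ `&` _).
by apply/setIidPl => x Bx Ax; have : (A `&` B) x by []; rewrite AB.
Qed.

End npoints.

(** * Weights independent of the number of points in a set *)

Section poisson_past.
Context {R : realType} {d dX : measure_display} {Omega : measurableType d}
  {X : measurableType dX} (P : probability Omega R) (Pi : Omega -> set X)
  (nu : set X -> \bar R).
Hypothesis hPi : poisson_process P Pi nu.
Local Notation npts := (@npoints R Omega X Pi).

Definition vacant (B : set X) : set Omega := [set w | npts w B = 0].

Lemma measurable_npoints_eq A o : measurable A ->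
  measurable [set w | npts w A = ncount o].
Proof. by move=> mA; case: hPi => h _ _ _; exact: h. Qed.

Lemma measurable_vacant B : measurable B -> measurable (vacant B).
Proof. exact: measurable_npoints_eq (Some 0%N). Qed.

Lemma measurable_npoints A : measurable A -> measurable_fun setT (npts ^~ A : Omega -> \bar R).
Proof.
move=> mA _ Y _; rewrite setTI.
have mn c : measurable [set w | npts w A = ncount c].
  exact: measurable_npoints_eq.
rewrite (_ : _ @^-1` _ = [set w | Y +oo /\ npts w A = ncount None] `|`
    \bigcup_(k in [set k | Y (ncount (Some k))])
      [set w | npts w A = ncount (Some k)]); last first.
  apply/seteqP; split=> [w /= Yw|w [/= [Yoo ->]//|[k /= Yk ->]//]].
  case: (@npoints_ncount R _ _ Pi w A) => -[k|] e; rewrite e in Yw.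
    by right; exists k.
  by left.
apply: measurableU; last by apply: bigcup_measurable => k _; exact: mn.
have [Yoo|Yoo] := pselect (Y +oo).
  by rewrite (_ : mkset _ = [set w | npts w A = ncount None])//;
    apply/seteqP; split=> w [].
by rewrite (_ : mkset _ = set0)//; apply/seteqP; split=> w [].
Qed.

Lemma vacantU A B : vacant (A `|` B) = vacant A `&` vacant B.
Proof.
apply/seteqP; split=> w.
  move=> /npoints_eq0 h; split; apply/npoints_eq0 => p /h h' ?; apply: h'.
    by left.
  by right.
move=> [/npoints_eq0 hA /npoints_eq0 hB]; apply/npoints_eq0 => p Pp.
by move=> [/(hA _ Pp)|/(hB _ Pp)].
Qed.

(* The weights [G] that only depend on the points of the process outside [A],
   in the form in which the explorations below use their independence from the
   number of points in [A]. *)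
Definition past (A : set X) (G : Omega -> \bar R) : Prop :=
  [/\ measurable_fun setT G, (forall w, 0 <= G w), \int[P]_w G w < +oo &
   forall B k, measurable B -> A `&` B = set0 ->
   \int[P]_(w in vacant B `&` [set w | npts w A = ncount (Some k)]) G w =
   P [set w | npts w A = ncount (Some k)] * \int[P]_(w in vacant B) G w].

(** The starting weight of every exploration; the claim is the independence of the counts in the
    disjoint sets [A] and [B], the latter count being 0. *)
Lemma past1 A : measurable A -> past A (cst 1).
Proof.
move=> mA; split => //=; first by rewrite integral_cst// mul1e -ge0_fin_numE// fin_num_measure.
move=> B k mB AB; rewrite !integral_cst ?mul1e//; last 2 first.
- exact: measurable_vacant.
- apply: measurableI; first exact: measurable_vacant.
  exact: (@measurable_npoints_eq A (Some k)).
case: hPi => _ _ _ /(_ 2%N (fun i => if i == ord0 then A else B)).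
move=> /(_ _ _ (fun i => if i == ord0 then Some k else Some 0%N)).
rewrite big_ord_recl big_ord1 /= => <-; last 2 first.
- by move=> i; case: ifP.
- by move=> [[|[|//]] p] [[|[|//]] q] //= _; rewrite // setIC.
congr (P _); apply/seteqP; split=> w.
  by move=> [wB wA] i _; case: ifP.
move=> h; split; first by have := h ord_max I.
by have := h ord0 I.
Qed.

Variables (A : set X) (mA : measurable A).

Lemma past_base G k : past A G ->
  \int[P]_(w in [set w | npts w A = ncount (Some k)]) G w =
  P [set w | npts w A = ncount (Some k)] * \int[P]_w G w.
Proof.
move=> [_ _ _ /(_ set0 k measurable0 (setI0 _))].
rewrite (_ : vacant set0 = setT) ?setTI//.
by apply/seteqP; split => // w _; apply/npoints_eq0 => p _ [].
Qed.

Lemma integral_restrict_fin G D : measurable D ->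
  measurable_fun setT G -> (forall w, 0 <= G w) -> \int[P]_w G w < +oo ->
  \int[P]_(w in D) G w \is a fin_num.
Proof.
move=> mD mG G0 fG; rewrite ge0_fin_numE ?integral_ge0//.
by apply: le_lt_trans fG; apply: ge0_subset_integral.
Qed.

(** Vacancy of [B] and of [C] is vacancy of their union, again disjoint from [A]. Testing weights
    against vacant sets thus makes [past] stable under such restrictions. *)
Lemma past_vacant G C : past A G -> measurable C -> A `&` C = set0 ->
  past A (G \_ (vacant C)).
Proof.
move=> [mG G0 fG hG] mC AC; have mvC := measurable_vacant mC; split.
- by apply/(measurable_restrictT _ mvC); exact: measurable_funTS.
- by move=> w; rewrite erestrict_ge0.
- by rewrite -integral_mkcond; apply: le_lt_trans fG; apply: ge0_subset_integral.
- move=> B k mB AB; rewrite -!integral_mkcondr setIAC -vacantU hG//.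
  + exact: measurableU.
  + by rewrite setIUr AB AC setU0.
Qed.

(** The restriction to a hit is [G] minus its restriction to vacancy; the integrals may be
    subtracted because [past] includes their finiteness. *)
Lemma past_hits G C : past A G -> measurable C -> A `&` C = set0 ->
  past A (G \_ (~` vacant C)).
Proof.
move=> pG mC AC; have [mG G0 fG hG] := pG.
have [_ _ _ hC] := past_vacant pG mC AC.
have mvC := measurable_vacant mC; have mhC := measurableC mvC; split.
- by apply/(measurable_restrictT _ mhC); exact: measurable_funTS.
- by move=> w; rewrite erestrict_ge0.
- by rewrite -integral_mkcond; apply: le_lt_trans fG; apply: ge0_subset_integral.
- move=> B k mB AB; set E := [set w | _]; have mE : measurable E.
    exact: measurable_npoints_eq.
  have mvB := measurable_vacant mB.
  have split_integral D : measurable D -> \int[P]_(w in D) (G \_ (~` vacant C)) w =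
      \int[P]_(w in D) G w - \int[P]_(w in D) (G \_ (vacant C)) w.
    move=> mD; rewrite -!integral_mkcondr.
    rewrite -[in X in X - _](setIT D) -(setUv (vacant C)) setIUr.
    rewrite ge0_integral_setU//; last 4 first.
    + exact: measurableI.
    + exact: measurableI.
    + exact: measurable_funTS.
    + by rewrite disj_set2E setIACA setICr setI0.
    rewrite addeAC subee ?add0e//; apply: integral_restrict_fin => //.
    exact: measurableI.
  rewrite !split_integral//; last exact: measurableI.
  rewrite hG// hC// [in RHS]muleBr// ?fin_num_measure//.
  by apply: fin_num_adde_defr; exact: integral_restrict_fin.
Qed.

Lemma past_scale G (c : R) : (0 <= c)%R -> past A G -> past A (fun w => c%:E * G w).
Proof.
move=> c0 [mG G0 fG hG]; split.
- exact: measurable_funeM.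
- by move=> w; rewrite mule_ge0.
- by rewrite ge0_integralZl// lte_mul_pinfty.
- move=> B k mB AB; rewrite !ge0_integralZl//.
  + by rewrite hG// muleCA.
  + exact: measurable_vacant.
  + exact: measurable_funTS.
  + by apply: measurableI; [exact: measurable_vacant|exact: measurable_npoints_eq].
  + exact: measurable_funTS.
Qed.

Lemma past_series (G : nat -> Omega -> \bar R) : (forall j, past A (G j)) ->
  \int[P]_w \sum_(j <oo) G j w < +oo -> past A (fun w => \sum_(j <oo) G j w).
Proof.
move=> pG fG; have mG j : measurable_fun setT (G j) by case: (pG j).
have G0 j w : 0 <= G j w by case: (pG j).
split => //.
- exact: ge0_emeasurable_sum.
- by move=> w; apply: nneseries_ge0.
- move=> B k mB AB; rewrite !integral_nneseries//; last 4 first.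
  + exact: measurable_vacant.
  + by move=> j; exact: measurable_funTS.
  + by apply: measurableI; [exact: measurable_vacant|exact: measurable_npoints_eq].
  + by move=> j; exact: measurable_funTS.
  set p := P _; have fp : p \is a fin_num.
    by rewrite fin_num_measure//; exact: measurable_npoints_eq.
  rewrite -(fineK fp) -nneseriesZl; last by move=> *; exact: integral_ge0.
  apply: eq_eseriesr => j _; rewrite fineK//.
  by case: (pG j) => _ _ _; apply.
Qed.

Hypothesis nuA : 0 < nu A < +oo.

Lemma nuA_fine : nu A = (fine (nu A))%:E /\ (0 < fine (nu A))%R.
Proof.
case/andP: nuA => n0 noo; split; first by rewrite fineK// ge0_fin_numE// ltW.
by rewrite fine_gt0// n0.
Qed.

Lemma prob_npoints k : P [set w | npts w A = ncount (Some k)] =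
  (poisson_pmf (fine (nu A)) k)%:E.
Proof.
have [e m0] := nuA_fine; case: hPi => _ /(_ A mA) h _ _.
rewrite h ?(andP nuA).2// /poisson_pmf m0.
by congr (_%:E); rewrite -mulrA mulrC.
Qed.

Lemma prob_vacant : P (vacant A) = (expR (- fine (nu A)))%:E.
Proof.
rewrite -[vacant A]/([set w | npts w A = ncount (Some 0%N)]) prob_npoints.
by rewrite /poisson_pmf nuA_fine.2 expr0 fact0 invr1 !mul1r.
Qed.

Lemma npoints_partition :
  \bigcup_k [set w | npts w A = ncount (Some k)] =
  ~` [set w | npts w A = ncount None].
Proof.
apply/seteqP; split=> [w [k _ /= ->]//|w].
by case: (@npoints_ncount R _ _ Pi w A) => -[k|] e //= _; exists k.
Qed.

Lemma trivIset_npoints :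
  trivIset setT (fun k => [set w | npts w A = ncount (Some k)]).
Proof.
apply/trivIsetP => i j _ _ ij; apply/seteqP; split => // w [/= -> []] /eqP.
by rewrite eqr_nat (negbTE ij).
Qed.

Lemma sum_poisson_pmf (m : R) : (0 < m)%R -> \sum_(k <oo) (poisson_pmf m k)%:E = 1.
Proof.
move=> m0; have := probability_setT (poisson_prob m 0).
rewrite /= /poisson_prob m0 -nneseries_esumT// => *.
by rewrite lee_fin poisson_pmf_ge0.
Qed.

Lemma prob_npoints_oo : P [set w | npts w A = ncount None] = 0.
Proof.
have mN : measurable [set w | npts w A = ncount None] by exact: measurable_npoints_eq.
have : P (~` [set w | npts w A = ncount None]) = 1.
  rewrite -npoints_partition measure_bigcup//; last 2 first.
  - by move=> k _; exact: (measurable_npoints_eq (Some k)).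
  - exact: trivIset_npoints.
  rewrite -[RHS](sum_poisson_pmf nuA_fine.2).
  rewrite (eq_eseriesl (Q := xpredT)); last by move=> k; rewrite in_setT.
  by apply: eq_eseriesr => k _; exact: prob_npoints.
rewrite probability_setC// -(@fineK _ (P _)) ?fin_num_measure// -EFinB => -[].
by move=> /eqP; rewrite subr_eq addrC -subr_eq subrr => /eqP <-.
Qed.

(** After removal of the null event of an infinite count, splitting by the value of the count and
    independence leave the mean of a Poisson law. *)
Lemma integral_past_npoints G : past A G ->
  \int[P]_w (G w * npts w A) = nu A * \int[P]_w G w.
Proof.
move=> pG; have [mG G0 fG _] := pG; have [em m0] := nuA_fine.
have mN : measurable [set w | npts w A = ncount None] by exact: measurable_npoints_eq.
have mGn : measurable_fun setT (fun w => G w * npts w A).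
  by apply: emeasurable_funM => //; exact: measurable_npoints.
have Gn0 w : 0 <= G w * npts w A by rewrite mule_ge0 ?npoints_ge0.
rewrite (ge0_negligible_integral mN)//; last exact: prob_npoints_oo.
rewrite setTD -npoints_partition ge0_integral_bigcup//; last 3 first.
- by move=> k; exact: measurable_npoints_eq.
- exact: measurable_funTS.
- exact: trivIset_npoints.
have -> : \sum_(k <oo) \int[P]_(w in [set w | npts w A = ncount (Some k)])
    (G w * npts w A) =
  \sum_(k <oo) (k%:R * poisson_pmf (fine (nu A)) k)%:E * \int[P]_w G w.
  apply: eq_eseriesr => k _.
  rewrite (eq_integral (fun w => (k%:R)%:E * G w)); last first.
    by move=> w /set_mem/= ->; rewrite muleC.
  rewrite ge0_integralZl//; last 2 first.
  - exact: measurable_npoints_eq.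
  - exact: measurable_funTS.
  by rewrite past_base// prob_npoints EFinM muleA.
have iG : \int[P]_w G w \is a fin_num by rewrite ge0_fin_numE ?integral_ge0.
under eq_eseriesr do rewrite -(fineK iG) muleC.
rewrite nneseriesZl; last first.
  by move=> k _; rewrite lee_fin mulr_ge0// poisson_pmf_ge0.
rewrite fineK// muleC; congr (_ * _).
(* The term at 0 vanishes; after a shift of the index, k + 1 times the mass at k + 1 equals the rate
   times the mass at k. *)
rewrite (nneseries_split _ 1)//; last first.
  by move=> k _; rewrite lee_fin mulr_ge0// poisson_pmf_ge0.
rewrite add0n big_nat1 mul0r add0e -nneseries_addn; last first.
  by move=> k; rewrite lee_fin mulr_ge0// poisson_pmf_ge0.
have -> : \sum_(k <oo) ((k + 1)%:R * poisson_pmf (fine (nu A)) (k + 1))%:E =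
  \sum_(k <oo) (fine (nu A))%:E * (poisson_pmf (fine (nu A)) k)%:E.
  apply: eq_eseriesr => k _; rewrite -EFinM; congr (_%:E).
  rewrite /poisson_pmf m0 addn1 factS natrM exprS invfM.
  have gen (u u' m x v e : R) : (u * u' = 1 ->
      u * (m * x * (u' * v) * e) = m * (x * v * e))%R.
    by move=> h; rewrite -[RHS]mul1r -h; ring.
  by rewrite gen// divff// pnatr_eq0.
rewrite nneseriesZl; last by move=> k _; rewrite lee_fin poisson_pmf_ge0.
by rewrite sum_poisson_pmf// mule1 -em.
Qed.

End poisson_past.

(** * Roads through an edge and roads turning at a vertex *)

Lemma ln_cvgy {R : realType} : (ln x : R) @[x --> +oo%R] --> +oo%R.
Proof.
apply/cvgryPge => A; near=> x.
have xA : (expR A <= x)%R by near: x; exact: nbhs_pinfty_ge.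
by rewrite -[A]expRK ler_ln// posrE ?expR_gt0// (lt_le_trans _ xA)// expR_gt0.
Unshelve. all: by end_near. Qed.

Lemma powR_cvgy0 {R : realType} (g : R) : (0 < g)%R ->
  (x `^ (- g))%R @[x --> +oo%R] --> 0%R.
Proof.
move=> g0; apply: (@cvg_trans _ ((expR (- (g * ln x)))%R @[x --> +oo%R])).
  apply: near_eq_cvg; near=> x.
  have x0 : (0 < x)%R by near: x; exact: nbhs_pinfty_gt.
  by rewrite /powR gt_eqF// mulNr.
have h : (g * ln x)%R @[x --> +oo%R] --> +oo%R.
  by apply: gt0_cvgMry => //; exact: ln_cvgy.
rewrite (_ : (fun x => expR (- (g * ln x))) =
    (fun y => expR (- y)) \o (fun x => g * ln x)%R)//.
by apply: (@cvg_comp _ _ _ _ _ _ (pinfty_nbhs R)); [exact: h|exact: cvgr_expR].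
Unshelve. all: by end_near. Qed.

(** The antiderivative -(beta - 1)^-1 v^(1 - beta) vanishes at infinity because [beta] exceeds 1.
    The factor (beta - 1)^-1 will cancel the constant in [intensity]. *)
Lemma speed_density_itv {R : realType} (beta s : R) : (1 < beta)%R -> (0 < s)%R ->
  speed_density beta `[s, +oo[ = ((beta - 1)^-1 * s `^ (1 - beta))%:E.
Proof.
move=> b1 s0; rewrite /speed_density.
have b0 : (0 < beta - 1)%R by rewrite subr_gt0.
have dpow (x : R) : (s <= x)%R -> is_derive x 1%R
    (fun v => - (beta - 1)^-1 * v `^ (1 - beta))%R (x `^ (- beta))%R.
  move=> sx; have x0 := lt_le_trans s0 sx.
  have := is_deriveZ (- (beta - 1)^-1)%R (is_derive1_powR (1 - beta)%R x0).
  rewrite scalerA (_ : - (beta - 1)^-1 * (1 - beta) = 1)%R; last first.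
    by rewrite mulNr -mulrN opprB mulVf// gt_eqF.
  by rewrite scale1r (_ : 1 - beta - 1 = - beta)%R//; ring.
have cpow (x : R) : (s <= x)%R ->
    {for x, continuous (fun v : R => (v `^ (- beta))%R)}.
  move=> sx; apply/differentiable_continuous/derivable1_diffP.
  by apply: derivable_powR; rewrite in_itv/= andbT (lt_le_trans s0).
rewrite (_ : _ `&` _ = [set` `[s, +oo[]); last first.
  apply/seteqP; split=> [x [//]|x /=].
  by rewrite !in_itv/= !andbT => sx; split => //; rewrite (lt_le_trans s0).
rewrite (@ge0_continuous_FTC2y R _
    (fun v => - (beta - 1)^-1 * v `^ (1 - beta))%R s 0%R).
- by rewrite -EFinB sub0r mulNr opprK.
- by move=> x _; exact: powR_ge0.
- apply/continuous_within_itvcyP; split.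
    by move=> x; rewrite in_itv/= andbT => /ltW; exact: cpow.
  by apply: cvg_at_right_filter; exact: cpow.
- rewrite -[X in _ --> X](mulr0 (- (beta - 1)^-1)%R).
  by apply: cvgMr; rewrite -opprB; exact: powR_cvgy0.
- by move=> x /ltW/dpow; case.
- apply: cvg_at_right_filter.
  suff : {for s, continuous (fun v : R => (- (beta - 1)^-1 * v `^ (1 - beta))%R)} by [].
  apply/differentiable_continuous/derivable1_diffP.
  by case: (dpow _ (lexx s)).
- by move=> x; rewrite in_itv/= andbT => /ltW/dpow[_ <-]; rewrite derive1E.
Qed.

Lemma geometric_nneseries {R : realType} (a x : R) : (0 <= x < 1)%R ->
  \sum_(k <oo) (a * x ^+ k)%:E = (a / (1 - x))%:E.
Proof.
move=> /andP[x0 x1]; apply: cvg_lim => //.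
rewrite (_ : (fun n => _) = EFin \o series (geometric a x)); last first.
  by apply/funext => n /=; rewrite sumEFin.
apply: cvg_EFin; first exact: nearW.
by apply: cvg_geometric_series; rewrite ger0_norm.
Qed.

Lemma nneseries_le {R : realType} (f : nat -> \bar R) B :
  (forall k, 0 <= f k) -> (forall n, \sum_(0 <= k < n) f k <= B) ->
  \sum_(k <oo) f k <= B.
Proof.
by move=> f0 h; apply: lime_le; [exact: is_cvg_nneseries|exact: nearW].
Qed.

Lemma measurable_thru x y : x <> y -> measurable (thru x y : set lineM).
Proof. by move=> xy; apply: sub_gen_smallest; exists x, y. Qed.

Lemma child0_neq_child1 z : child z ord0 <> child z ord_max.
Proof. by move=> /child_inj. Qed.

Lemma parent_neq y : y <> [::] -> parent y <> y.
Proof.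
move=> y0 /(congr1 size); rewrite size_take.
by case: y y0 => //= a y _; rewrite ltnSn; lia.
Qed.

Section roads.
Context {R : realType}.

Definition edge_roads (y : vert) (s : R) : set (lineM * R) :=
  thru (parent y) y `*` `[s, +oo[.

Definition turn_roads (z : vert) (s : R) : set (lineM * R) :=
  thru (child z ord0) (child z ord_max) `*` `[s, +oo[.

Lemma measurable_edge_roads y s : y <> [::] -> measurable (edge_roads y s).
Proof.
move=> y0; apply: measurableX; last exact: measurable_itv.
by apply: measurable_thru; exact: parent_neq.
Qed.

Lemma measurable_turn_roads z s : measurable (turn_roads z s).
Proof.
apply: measurableX; last exact: measurable_itv.
by apply: measurable_thru; exact: child0_neq_child1.
Qed.

Lemma turn_roads_disjoint z s (B : set (lineM * R)) :
  (forall p, B p -> exists u : vert, [/\ lset p.1 u, prefix u z & u <> z]) ->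
  turn_roads z s `&` B = set0.
Proof.
move=> h; apply/seteqP; split => // p [[/= [L0 L1] _] /h[u [Lu uz nuz]]].
exact: (line_no_turn Lu uz nuz (isT : (ord0 : 'I_2) != ord_max) L0 L1).
Qed.

(** The witness is [parent y], a proper ancestor of [z]. The case [z = y] is included: a road
    through the edge above [y] cannot visit both children of [y]. *)
Lemma turn_edge_disjoint y z s t : y <> [::] -> prefix y z ->
  turn_roads z s `&` edge_roads y t = set0.
Proof.
move=> y0 yz; apply: turn_roads_disjoint => p [[/= Lp _] _].
exists (parent y); split => //.
  by apply: prefix_trans yz; exact: prefix_take.
move=> e; apply: (parent_neq y0).
have /= := size_prefix yz; rewrite -e /parent size_take => h.
by rewrite take_oversize//; case: ifP h => //; lia.
Qed.

Variables (beta : R) (hbeta : (1 < beta)%R) (mu : {measure set lineM -> \bar R}).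
Hypothesis hmu : forall x y : vert, reduced x -> reduced y -> x <> y ->
  mu (thru x y) = ((2 ^- dist x y)%R)%:E.

Lemma intensity_itv (B : set lineM) (s : R) : measurable B -> (0 < s)%R ->
  intensity beta mu (B `*` `[s, +oo[) = mu B * (s `^ (1 - beta))%:E.
Proof.
move=> mB s0; rewrite /intensity /product_measure1.
rewrite (eq_integral (fun L => speed_density beta `[s, +oo[ * (\1_B L)%:E)); last first.
  move=> L _ /=; rewrite indicE; have [LB|LB] := boolP (L \in B).
    by rewrite in_xsectionX// mule1.
  rewrite notin_xsectionX// mule0 /speed_density set0I integral_set0//.
rewrite speed_density_itv// ge0_integralZl_EFin//; last 2 first.
- by apply/measurable_EFinP; exact: measurable_indic.
- by rewrite mulr_ge0 ?powR_ge0// invr_ge0 subr_ge0 ltW.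
rewrite integral_indic// setIT muleA -EFinM mulrA mulfV ?mul1r 1?muleC//.
by rewrite gt_eqF// subr_gt0.
Qed.

Lemma reduced_parent y : reduced y -> reduced (parent y).
Proof. by rewrite /reduced /parent; exact: take_sorted. Qed.

Lemma intensity_edge_roads y s : y <> [::] -> reduced y -> (0 < s)%R ->
  intensity beta mu (edge_roads y s) = (2^-1 * s `^ (1 - beta))%:E.
Proof.
move=> y0 ry s0; have py := parent_neq y0.
rewrite intensity_itv//; last exact: measurable_thru.
rewrite hmu ?reduced_parent// dist_prefix ?prefix_take// -EFinM.
rewrite (_ : (_ - _)%N = 1%N) ?expr1// size_take.
by case: y y0 {ry py} => //= a y _; rewrite ltnSn subSnn.
Qed.

Lemma intensity_turn_roads z s : reduced z -> (0 < s)%R ->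
  intensity beta mu (turn_roads z s) = (4^-1 * s `^ (1 - beta))%:E.
Proof.
move=> rz s0; rewrite intensity_itv//; last first.
  by apply: measurable_thru; exact: child0_neq_child1.
rewrite hmu ?reduced_child//; last exact: child0_neq_child1.
rewrite dist_child// -EFinM; congr (_ * _)%:E; rewrite expr2 -natrM//.
Qed.

End roads.

Section road_counts.
Context {R : realType} {Omega : Type} (Pi : Omega -> set (lineM * R)).
Local Notation npts := (@npoints R Omega (lineM * R)%type Pi).

(* Every road through an edge leaves its far endpoint through exactly one child;
   a road that turns at that endpoint is counted by both children. *)
Lemma npoints_children w y s : y <> [::] ->
  npts w (edge_roads (child y ord0) s) + npts w (edge_roads (child y ord_max) s) =
  npts w (edge_roads y s) + (npts w (turn_roads y s) + npts w (turn_roads y s)).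
Proof.
move=> y0; set E := edge_roads y s; set A := turn_roads y s.
pose E_ i := edge_roads (child y i) s.
rewrite -/(E_ ord0) -/(E_ ord_max).
have pc i : parent (child y i) = y by rewrite /child parent_rcons.
have three (L : line) : lset L (parent y) -> lset L (child y ord0) ->
  lset L (child y ord_max) -> False by exact: line_not_three.
have two (L : line) := @line_two_neighbors L y y0.
have between (L : line) := @line_between L y ord0 ord_max isT.
have e0 : E_ ord0 = (E_ ord0 `&` E) `|` A.
  apply/seteqP; split=> -[L v] /=; rewrite /E_ /E /A /edge_roads /turn_roads /thru pc/=.
    move=> [[Ly L0] sv]; have [[Lp _]|[Lp L1]|[_ L1]] := two _ Ly.
    + by left.
    + by left.
    + by right.
  by move=> [[[]]|[[L0 L1] sv]]//; split => //; split => //; exact: between.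
have e1 : E_ ord_max = (E_ ord_max `&` E) `|` A.
  apply/seteqP; split=> -[L v] /=; rewrite /E_ /E /A /edge_roads /turn_roads /thru pc/=.
    move=> [[Ly L1] sv]; have [[Lp L0]|[Lp _]|[L0 _]] := two _ Ly.
    + by left.
    + by left.
    + by right.
  by move=> [[[]]|[[L0 L1] sv]]//; split => //; split => //; exact: between.
have e : E = (E_ ord0 `&` E) `|` (E_ ord_max `&` E).
  apply/seteqP; split=> -[L v] /=; rewrite /E_ /E /edge_roads /thru !pc/=; last by case=> -[].
  move=> [[Lp Ly] sv]; have [[_ L0]|[_ L1]|[L0 _]] := two _ Ly.
  + by left.
  + by right.
  + by left.
rewrite [in LHS]e0 [in LHS]e1 [in RHS]e !npointsU.
- by rewrite addeACA.
- apply/seteqP; split => // -[L v] [[[[/= _ L0] _] [[Lp _] _]]]; rewrite /E_ /edge_roads /thru/=.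
  by move=> [[[_ L1] _] _]; exact: (three L).
- by apply/seteqP; split => // -[L v] [[_ [[/= Lp _] _]] [[/= L0 L1] _]]; exact: (three L).
- by apply/seteqP; split => // -[L v] [[_ [[/= Lp _] _]] [[/= L0 L1] _]]; exact: (three L).
Qed.

End road_counts.

(** * The case beta > 2 *)

Section discount.
Context {R : realType} (C : R) (C0 : (0 <= C)%R).

(* [discount k.+1] is the discount factor of an edge whose fastest road has a
   speed in [2 ^ k, 2 ^ k.+1); [discount 0] is that of an edge without roads of
   speed at least 1. *)
Definition discount (k : nat) : R :=
  if k is j.+1 then expR (- (2 * C / 2 ^+ j)) else 0%R.

Lemma discount_ge0 k : (0 <= discount k)%R.
Proof. by case: k => //= k; exact: expR_ge0. Qed.

Lemma discount_le1 k : (discount k <= 1)%R.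
Proof.
case: k => //= k; rewrite -[leRHS]expR0 ler_expR oppr_le0.
by rewrite divr_ge0 ?mulr_ge0 ?exprn_ge0.
Qed.

Lemma discount_nondecreasing : nondecreasing_seq discount.
Proof.
apply/nondecreasing_seqP => -[|k]; first exact: discount_ge0.
rewrite /= ler_expR lerN2 ler_wpM2l ?mulr_ge0// lef_pV2 ?posrE ?exprn_gt0//.
by rewrite ler_eXn2l ?ltr1n.
Qed.

Lemma discount_step_ge0 k : (0 <= discount k.+1 - discount k)%R.
Proof. by rewrite subr_ge0 discount_nondecreasing. Qed.

Variable h : nat -> bool.
Hypothesis hh : forall j k, (j <= k)%N -> h k -> h j.

(** Summation by parts: if [h] holds exactly below [K], the series telescopes to [discount K]. As a
    nonnegative combination of indicators it lets measurability and [past] be checked term by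
    term. *)
Definition discount_series : \bar R :=
  \sum_(k <oo) ((discount k.+1 - discount k) * (h k)%:R)%:E.

Lemma discount_term_ge0 k : 0 <= ((discount k.+1 - discount k) * (h k)%:R)%:E.
Proof. by rewrite lee_fin mulr_ge0// discount_step_ge0. Qed.

Lemma discount_series_le K : ~~ h K -> discount_series <= (discount K)%:E.
Proof.
move=> nhK; apply: nneseries_le => [k|n]; first exact: discount_term_ge0.
suff : (\sum_(0 <= k < n) (discount k.+1 - discount k) * (h k)%:R <=
  discount (minn n K))%R.
  rewrite sumEFin lee_fin => /le_trans; apply.
  by apply: discount_nondecreasing; exact: geq_minr.
elim: n => [|n IH]; first by rewrite big_geq// discount_ge0.
rewrite big_nat_recr//=; have [nK|Kn] := ltnP n K.
  move: IH; rewrite (minn_idPl (ltnW nK)) (minn_idPl nK) => IH.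
  apply: le_trans (lerD IH (ler_piMr _ _)) _.
  - exact: discount_step_ge0.
  - by case: (h n).
  - by rewrite addrC subrK.
have /negbTE-> : ~~ h n by apply: contra nhK; exact: hh.
by move: IH; rewrite mulr0 addr0 !(minn_idPr _)// ltnW.
Qed.

Lemma discount_series_le1 : discount_series <= 1.
Proof.
apply: nneseries_le => [k|n]; first exact: discount_term_ge0.
rewrite sumEFin lee_fin.
apply: (@le_trans _ _ (\sum_(0 <= k < n) (discount k.+1 - discount k))%R).
  apply: ler_sum => k _; rewrite ler_piMr ?discount_step_ge0//.
  by case: (h k).
by rewrite telescope_sumr// subr0 discount_le1.
Qed.

Lemma discount_series_ge0 : 0 <= discount_series.
Proof. by apply: nneseries_ge0 => k _ _; exact: discount_term_ge0. Qed.

Lemma discount_series_ge K : h K -> (discount K.+1)%:E <= discount_series.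
Proof.
move=> hK; apply: (@le_trans _ _ (\sum_(0 <= k < K.+1)
    ((discount k.+1 - discount k) * (h k)%:R)%:E)); last first.
  by apply: nneseries_lim_ge => k _ _; exact: discount_term_ge0.
rewrite sumEFin lee_fin big_nat.
rewrite (eq_bigr (fun k => discount k.+1 - discount k)%R); last first.
  by move=> k /= /ltnSE kK; rewrite (hh kK hK) mulr1.
by rewrite -big_nat telescope_sumr// subr0.
Qed.

(* The exponent in [discount] is chosen for this inequality: [exp x >= 1 + x]. *)
Lemma discount_series_contract (S : \bar R) : 0 <= S ->
  (forall k, h k -> (2 ^+ k)%:E <= S) ->
  discount_series * (S + (2 * C)%:E) <= S.
Proof.
case: S => [s| |]//; last by move=> _ _; exact: leey.
rewrite lee_fin => s0 hS.
have hn : exists K, ~~ h K.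
  exists (Num.truncn s).+1; apply/negP => /hS; rewrite lee_fin leNgt => /negP; apply.
  apply: lt_le_trans (truncnS_gt s) _.
  by rewrite -natrX ler_nat ltnW// ltn_expl.
case: (ex_minnP hn) => K nhK Kmin.
apply: (@le_trans _ _ ((discount K)%:E * (s + 2 * C)%:E)).
  rewrite EFinD lee_wpmul2r ?discount_series_le// -EFinD lee_fin.
  by rewrite addr_ge0// mulr_ge0.
(* For [K = 0] the discount vanishes. Otherwise [K] now denotes the last level present, so that 2^K
   is at most [s] and the discount is exp(-2 C / 2^K). *)
rewrite -EFinM lee_fin; case: K nhK Kmin => [|K] nhK Kmin; first by rewrite mul0r.
have /hS : h K by apply: contraT => /Kmin; rewrite ltnn.
rewrite lee_fin => sK; rewrite /= expRN ler_pdivrMl ?expR_gt0//.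
have K0 : (0 < 2 ^+ K :> R)%R by rewrite exprn_gt0.
apply: (@le_trans _ _ ((1 + 2 * C / 2 ^+ K) * s)%R); last first.
  by rewrite ler_wpM2r// expR_ge1Dx.
rewrite [leRHS]mulrDl mul1r lerD2l mulrAC ler_pdivlMr//.
by rewrite ler_wpM2l ?mulr_ge0.
Qed.

End discount.

(** * Driving times of edges and paths from the root *)

Section driving.
Context {R : realType} {Omega : Type} (Pi : Omega -> set (lineM * R)).

(** The supremum defining [speed] may fail to be attained, hence the strict inequality here and in
    [edge_time_lt]. *)
Lemma speed_gt (w : Omega) y (s : R) : s%:E < speed Pi w (parent y) y ->
  npoints Pi w (edge_roads y s) <> 0 :> \bar R.
Proof.
move=> /ereal_sup_gt[_ [v [L [PL [Lp Ly]]] <-]]; rewrite lte_fin => sv.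
move=> /npoints_eq0 /(_ _ PL); apply; split => //=.
by rewrite in_itv/= andbT ltW.
Qed.

Lemma edge_time_lt (w : Omega) y (s : R) : (0 < s)%R ->
  edge_time Pi w (parent y) y < (s^-1)%:E ->
  npoints Pi w (edge_roads y s) <> 0 :> \bar R.
Proof.
rewrite /edge_time => s0 h; apply: speed_gt; move: h.
case: speed => [r| |]//; last by rewrite ltry.
by case: ifP => // r0; rewrite !lte_fin ltf_pV2.
Qed.

Lemma edge_time_le (w : Omega) y (s : R) : (0 < s)%R ->
  npoints Pi w (edge_roads y s) <> 0 :> \bar R ->
  edge_time Pi w (parent y) y <= (s^-1)%:E.
Proof.
move=> s0 n0.
have : s%:E <= speed Pi w (parent y) y.
  apply: contrapT => /negP; rewrite -ltNge => hs; apply: n0.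
  apply/npoints_eq0 => -[L v] PL [[/= Lp Ly]]; rewrite in_itv/= andbT => sv.
  have : v%:E <= speed Pi w (parent y) y.
    by apply: ereal_sup_ubound; exists v => //; exists L.
  by rewrite leNgt (lt_le_trans hs)// lee_fin.
rewrite /edge_time; case: speed => [r| |]//=.
  rewrite lee_fin => sr; rewrite (lt_le_trans s0 sr) lee_fin.
  by rewrite lef_pV2 ?posrE// (lt_le_trans s0).
by move=> _; rewrite lee_fin invr_ge0 ltW.
Qed.

Lemma edge_time_ge0 (w : Omega) u v : 0 <= edge_time Pi w u v.
Proof.
by rewrite /edge_time; case: speed => [r| |]//; case: ifP => // r0;
  rewrite lee_fin invr_ge0 ltW.
Qed.

Lemma drive_parent (w : Omega) y : y <> [::] ->
  drive Pi w (parent y) y = edge_time Pi w (parent y) y.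
Proof.
case/lastP: y => // z c _; rewrite parent_rcons /drive lcp_prefix ?prefix_rcons//.
rewrite big_geq// add0e size_rcons big_nat1 -cats1 take_size_cat//.
by rewrite take_oversize// size_cat addn1.
Qed.

Lemma size_root_geodesic (x : nat -> vert) n : root_geodesic x -> size (x n) = n.
Proof.
move=> [x0 [_ dx]]; have := dx 0%N n; rewrite x0 dist_prefix ?prefix0s// => e.
by move: e; rewrite /= subn0; lia.
Qed.

Lemma parent_root_geodesic (x : nat -> vert) n : root_geodesic x ->
  parent (x n.+1) = x n.
Proof.
move=> gx; have sn := size_root_geodesic n gx; have sn1 := size_root_geodesic n.+1 gx.
case: gx => _ [_ dx]; have := dx n n.+1; rewrite /dist sn sn1 => e.
have /lcp_size : lcp (x n) (x n.+1) = size (x n).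
  by have := lcp_le_size (x n) (x n.+1); rewrite sn; lia.
by rewrite prefixE /parent sn sn1 => /eqP.
Qed.

Lemma root_geodesic_neq0 (x : nat -> vert) n : root_geodesic x -> x n.+1 <> [::].
Proof. by move=> /(size_root_geodesic n.+1) + e; rewrite e. Qed.

Lemma drive_root_geodesic (x : nat -> vert) (w : Omega) n : root_geodesic x ->
  drive Pi w (x n) (x n.+1) = edge_time Pi w (parent (x n.+1)) (x n.+1).
Proof.
move=> gx; rewrite -[in LHS](parent_root_geodesic n gx) drive_parent//.
exact: root_geodesic_neq0.
Qed.

(** The index starts at 1 because [child] misses one neighbour of the root. *)
Lemma root_geodesic_child (x : nat -> vert) n : root_geodesic x ->
  exists i, x n.+2 = child (x n.+1) i.
Proof.
move=> gx; have := parent_root_geodesic n.+1 gx.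
have : reduced (x n.+2) by case: gx => _ [rx _]; exact: rx.
case/lastP: (x n.+2) (root_geodesic_neq0 (n := n.+1) gx) => // z c _ rz.
rewrite parent_rcons => zx; rewrite zx in rz *.
by apply: rcons_child => //; exact: root_geodesic_neq0.
Qed.

End driving.

Section past_below.
Context {R : realType} {d : measure_display} {Omega : measurableType d}
  (P : probability Omega R) (Pi : Omega -> set (lineM * R)).

(** The hypothesis carried down the tree for both ranges of [beta]: the weight is independent of the
    turns at [y] and at all its descendants, at every level. Finite values allow it to be moved into
    and out of series. *)
Definition past_below (y : vert) (G : Omega -> \bar R) : Prop :=
  (forall w, G w \is a fin_num) /\
  forall z k, prefix y z -> reduced z -> past P Pi (turn_roads z (2 ^+ k)) G.

Lemma past_below_ge0 y G w : past_below y G -> reduced y -> 0 <= G w.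
Proof. by move=> [_ /(_ y 0%N)] h ry; case: (h (prefix_refl y) ry). Qed.

Lemma past_below_measurable y G : past_below y G -> reduced y ->
  measurable_fun setT G.
Proof. by move=> [_ /(_ y 0%N)] h ry; case: (h (prefix_refl y) ry). Qed.

Lemma past_below_child y G i : past_below y G -> past_below (child y i) G.
Proof.
move=> [fG pG]; split => // z k yz; apply: pG.
by apply: prefix_trans yz; exact: prefix_rcons.
Qed.

End past_below.

(** * Discounted sums over descendants *)

Section supercritical.
Context {R : realType} {beta : R} (hbeta : (2 < beta)%R).
Context {mu : {measure set lineM -> \bar R}}.
Hypothesis hmu : forall x y : vert, reduced x -> reduced y -> x <> y ->
  mu (thru x y) = ((2 ^- dist x y)%R)%:E.
Context {d : measure_display} {Omega : measurableType d} (P : probability Omega R)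
  (Pi : Omega -> set (lineM * R)).
Hypothesis hPi : poisson_process P Pi (intensity beta mu).
Local Notation npts := (@npoints R Omega (lineM * R)%type Pi).
Local Notation past := (@past R _ _ Omega (lineM * R)%type P Pi).
Local Notation vacant := (@vacant R _ _ Omega (lineM * R)%type Pi).

Let hbeta1 : (1 < beta)%R. Proof. by apply: lt_trans hbeta; rewrite ltr1n. Qed.

(** Level [k] roads have weight 2^k and a rate proportional to 2^(k (1 - beta)); the product is
    proportional to [ratio ^+ k], which is summable since [beta > 2]. *)
Definition ratio : R := (2 `^ (2 - beta))%R.

Lemma ratio_itv : (0 <= ratio < 1)%R.
Proof.
rewrite powR_ge0/= -[ltRHS](powRr0 2) /ratio /powR pnatr_eq0/= ltr_expR mul0r.
by rewrite pmulr_llt0 ?ln_gt0 ?ltr1n// subr_lt0.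
Qed.

(** The mean of [turn_flow] at a vertex, see [integral_turn_flow]: the sum of [4^-1 * ratio ^+ k]
    over all levels. *)
Definition flux : R := (4^-1 / (1 - ratio))%R.

Lemma flux_ge0 : (0 <= flux)%R.
Proof. by case/andP: ratio_itv => _ /ltW r1; rewrite divr_ge0// subr_ge0. Qed.

Lemma level_rate (c : R) k :
  (2 ^+ k * (c * (2 ^+ k) `^ (1 - beta)) = c * ratio ^+ k)%R.
Proof.
rewrite mulrCA; congr (_ * _)%R.
have e : (2 ^+ k = 2 `^ k%:R :> R)%R by rewrite powR_mulrn.
rewrite -[RHS]powR_mulrn ?powR_ge0// /ratio e -!powRrM -powRD; last first.
  by rewrite pnatr_eq0 implybT.
by congr powR; ring.
Qed.

Local Notation past_below := (@past_below R _ Omega P Pi).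

(** [edge_flow] is the S(y) and [turn_flow] the N(y) of the opening overview. The dyadic weights
    make the contribution of a road of speed at least 1 comparable to its speed. *)
Definition edge_flow (y : vert) (w : Omega) : \bar R :=
  \sum_(k <oo) (2 ^+ k)%:E * npts w (edge_roads y (2 ^+ k)).

Definition turn_flow (y : vert) (w : Omega) : \bar R :=
  \sum_(k <oo) (2 ^+ k)%:E * npts w (turn_roads y (2 ^+ k)).

Definition hit (y : vert) (w : Omega) (k : nat) : bool :=
  w \in ~` vacant (edge_roads y (2 ^+ k)).

Definition edge_discount (y : vert) (w : Omega) : \bar R :=
  discount_series flux (hit y w).

Lemma hit_decreasing y w j k : (j <= k)%N -> hit y w k -> hit y w j.
Proof.
move=> jk /set_mem hk; apply/mem_set => /npoints_eq0 hj; apply: hk.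
apply/npoints_eq0 => p Pp [/= pt]; rewrite in_itv/= andbT => pk; apply: (hj _ Pp).
split => //=; rewrite in_itv/= andbT; apply: le_trans pk.
by rewrite ler_eXn2l ?ltr1n.
Qed.

Lemma pow2_ge0 k : 0 <= (2 ^+ k : R)%:E.
Proof. by rewrite lee_fin exprn_ge0. Qed.

Lemma pow2_gt0 k : (0 < 2 ^+ k :> R)%R.
Proof. by rewrite exprn_gt0. Qed.

Lemma flow_term_ge0 w k B : 0 <= (2 ^+ k : R)%:E * npts w B.
Proof. by rewrite mule_ge0 ?pow2_ge0 ?npoints_ge0. Qed.

Hint Resolve flow_term_ge0 pow2_gt0 : core.

Lemma edge_flow_ge0 y w : 0 <= edge_flow y w.
Proof. exact: nneseries_ge0. Qed.

Lemma turn_flow_ge0 y w : 0 <= turn_flow y w.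
Proof. exact: nneseries_ge0. Qed.

Lemma edge_flow_ge y w k : hit y w k -> (2 ^+ k)%:E <= edge_flow y w.
Proof.
move=> /set_mem hk.
apply: (@le_trans _ _ (\sum_(0 <= j < k.+1)
    (2 ^+ j)%:E * npts w (edge_roads y (2 ^+ j)))); last first.
  exact: nneseries_lim_ge.
rewrite big_nat_recr//=; apply: (@le_trans _ _
    ((2 ^+ k)%:E * npts w (edge_roads y (2 ^+ k)))).
  rewrite -[leLHS]mule1 lee_wpmul2l ?pow2_ge0// leNgt; apply/negP => h1.
  apply: hk; apply/npoints_eq0 => p Pp pE.
  by have := @npoints_ge1 R _ _ Pi w _ p Pp pE; rewrite leNgt h1.
by rewrite leeDr// sume_ge0.
Qed.

Lemma edge_flow_children y w : y <> [::] ->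
  edge_flow (child y ord0) w + edge_flow (child y ord_max) w =
  edge_flow y w + (turn_flow y w + turn_flow y w).
Proof.
move=> y0; rewrite /edge_flow /turn_flow -!nneseriesD//; last first.
  by move=> *; rewrite adde_ge0.
apply: eq_eseriesr => k _.
by rewrite -!ge0_muleDr ?adde_ge0 ?npoints_ge0// npoints_children.
Qed.

Lemma measurable_edge_flow y : y <> [::] -> measurable_fun setT (edge_flow y).
Proof.
move=> y0; apply: ge0_emeasurable_sum => // k _; apply: measurable_funeM.
exact: (measurable_npoints hPi (measurable_edge_roads _ y0)).
Qed.

Lemma measurable_turn_flow y : measurable_fun setT (turn_flow y).
Proof.
apply: ge0_emeasurable_sum => // k _; apply: measurable_funeM.
exact: (measurable_npoints hPi (measurable_turn_roads _ _)).
Qed.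

Lemma measurable_hits y k : y <> [::] ->
  measurable (~` vacant (edge_roads y (2 ^+ k))).
Proof.
move=> y0; apply: measurableC; apply: (measurable_vacant hPi).
exact: measurable_edge_roads.
Qed.

Lemma measurable_edge_discount y : y <> [::] ->
  measurable_fun setT (edge_discount y).
Proof.
move=> y0; apply: ge0_emeasurable_sum => [k w _ _|k _].
  exact: discount_term_ge0 flux_ge0 _ _.
apply/measurable_EFinP; apply: measurable_funM => //.
by apply: measurable_indic; exact: measurable_hits.
Qed.

Lemma edge_discount_ge0 y w : 0 <= edge_discount y w.
Proof. exact: discount_series_ge0 flux_ge0 _. Qed.

Lemma edge_discount_le1 y w : edge_discount y w <= 1.
Proof. exact: discount_series_le1 flux_ge0 _. Qed.

Lemma edge_discount_contract y w :
  edge_discount y w * (edge_flow y w + (2 * flux)%:E) <= edge_flow y w.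
Proof.
apply: discount_series_contract; first exact: flux_ge0.
- by move=> j k; exact: hit_decreasing.
- exact: edge_flow_ge0.
- by move=> k; exact: edge_flow_ge.
Qed.

(** The discount depends only on roads through the edge above [y], none of which turns at [y] or
    below. It is expanded into indicators of hits, to which [past_hits], [past_scale] and
    [past_series] apply. *)
Lemma past_below_discount y G : y <> [::] -> past_below y G ->
  past_below y (fun w => G w * edge_discount y w).
Proof.
move=> y0 [fG pG]; split.
  move=> w; rewrite fin_numM// ge0_fin_numE ?edge_discount_ge0//.
  by apply: le_lt_trans (edge_discount_le1 _ _) _; exact: ltry.
move=> z k yz rz; have [mG G0 iG _] := pG z k yz rz.
have eG : (fun w => G w * edge_discount y w) = (fun w => \sum_(j <oo)
    (discount flux j.+1 - discount flux j)%:E *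
      (G \_ (~` vacant (edge_roads y (2 ^+ j)))) w).
  apply/funext => w; rewrite -(fineK (fG w)) -nneseriesZl; last first.
    by move=> j _; exact: discount_term_ge0 flux_ge0 _ _.
  apply: eq_eseriesr => j _; rewrite fineK// patchE /hit EFinM muleCA; congr (_ * _).
  by case: ifPn; rewrite ?mule1 ?mule0.
rewrite eG; apply: (past_series hPi).
- exact: measurable_turn_roads.
- move=> j; apply: (past_scale hPi) => //; first exact: measurable_turn_roads.
    exact: discount_step_ge0 flux_ge0 _.
  apply: (past_hits hPi) => //.
  + exact: measurable_turn_roads.
  + exact: pG.
  + exact: measurable_edge_roads.
  + exact: turn_edge_disjoint.
- rewrite -eG; apply: le_lt_trans iG; apply: ge0_le_integral => //.
  + by move=> w _; rewrite mule_ge0 ?edge_discount_ge0.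
  + by apply: emeasurable_funM => //; exact: measurable_edge_discount.
  + by move=> w _; rewrite -[leRHS]mule1 lee_wpmul2l ?edge_discount_le1.
Qed.

Lemma intensity_turn_roads_itv z k : reduced z ->
  0 < intensity beta mu (turn_roads z (2 ^+ k)) < +oo.
Proof.
move=> rz; rewrite intensity_turn_roads// ltry andbT lte_fin.
by rewrite mulr_gt0 ?powR_gt0.
Qed.

Lemma integral_turn_flow y G : reduced y -> past_below y G ->
  \int[P]_w (G w * turn_flow y w) = flux%:E * \int[P]_w G w.
Proof.
move=> ry pG; have mG := past_below_measurable pG ry.
have G0 w := past_below_ge0 w pG ry.
have [fG pG'] := pG.
under eq_integral => w _ do rewrite -(fineK (fG w)) /turn_flow -nneseriesZl//.
rewrite integral_nneseries//; last 2 first.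
- move=> k; under eq_fun do rewrite fineK// muleCA.
  apply: measurable_funeM; apply: emeasurable_funM => //.
  exact: (measurable_npoints hPi (measurable_turn_roads _ _)).
- by move=> k w _; rewrite mule_ge0// fineK.
have iG : \int[P]_w G w \is a fin_num.
  rewrite ge0_fin_numE ?integral_ge0//.
  by case: (pG' y 0%N (prefix_refl y) ry).
rewrite (eq_eseriesr (g := fun k => \int[P]_w G w * (4^-1 * ratio ^+ k)%:E)).
  under eq_eseriesr do rewrite -(fineK iG).
  rewrite nneseriesZl; last first.
    by move=> k _; rewrite lee_fin mulr_ge0// exprn_ge0//; case/andP: ratio_itv.
  by rewrite geometric_nneseries ?ratio_itv// fineK// muleC.
move=> k _; under eq_integral => w _ do rewrite fineK// muleCA.
rewrite ge0_integralZl//; last 2 first.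
- apply: emeasurable_funM => //.
  exact: (measurable_npoints hPi (measurable_turn_roads _ _)).
- by move=> w _; rewrite mule_ge0 ?npoints_ge0.
rewrite (integral_past_npoints hPi)//.
- by rewrite intensity_turn_roads// muleA -EFinM level_rate muleC.
- exact: measurable_turn_roads.
- exact: intensity_turn_roads_itv.
- exact: pG' (prefix_refl y) ry.
Qed.

(** Unfolded, this sums [edge_flow] over the 2^n descendants at distance [n], each weighted by the
    discounts of the edges from the one above [y] down to, but excluding, the one above the
    descendant. *)
Fixpoint discounted_flow (n : nat) (y : vert) (w : Omega) : \bar R :=
  if n is n'.+1 then
    edge_discount y w * (discounted_flow n' (child y ord0) w +
                         discounted_flow n' (child y ord_max) w)
  else edge_flow y w.

Lemma discounted_flow_ge0 n y w : 0 <= discounted_flow n y w.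
Proof.
elim: n y => [|n IH] y; first exact: edge_flow_ge0.
by rewrite /= mule_ge0 ?edge_discount_ge0 ?adde_ge0.
Qed.

Lemma child_neq0 y i : child y i <> [::].
Proof. by rewrite /child; case: y. Qed.

Lemma measurable_discounted_flow n y : y <> [::] ->
  measurable_fun setT (discounted_flow n y).
Proof.
elim: n y => [|n IH] y y0; first exact: measurable_edge_flow.
apply: emeasurable_funM; first exact: measurable_edge_discount.
by apply: emeasurable_funD; apply: IH; exact: child_neq0.
Qed.

(** A supermartingale estimate; the arbitrary weight [G] lets the induction absorb the discount of
    the current edge into the weight of both children. *)
Lemma integral_discounted_flow n y G : y <> [::] -> reduced y -> past_below y G ->
  \int[P]_w (G w * discounted_flow n y w) <= \int[P]_w (G w * edge_flow y w).
Proof.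
elim: n y G => [//|n IH] y G y0 ry pG /=.
have mG := past_below_measurable pG ry; have G0 w := past_below_ge0 w pG ry.
have pH := past_below_discount y0 pG.
set H := fun w => G w * edge_discount y w in pH.
have mH := past_below_measurable pH ry; have H0 w := past_below_ge0 w pH ry.
have D0 := discounted_flow_ge0; have F0 := edge_flow_ge0.
have mD i := measurable_discounted_flow n (@child_neq0 y i).
have mF i := measurable_edge_flow (@child_neq0 y i).
have -> : (fun w => G w * (edge_discount y w * (discounted_flow n (child y ord0) w +
    discounted_flow n (child y ord_max) w))) =
  (fun w => H w * discounted_flow n (child y ord0) w +
    H w * discounted_flow n (child y ord_max) w).
  by apply/funext => w; rewrite muleA ge0_muleDr.
rewrite ge0_integralD//; last 4 first.
- by move=> w _; rewrite mule_ge0.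
- exact: emeasurable_funM.
- by move=> w _; rewrite mule_ge0.
- exact: emeasurable_funM.
apply: le_trans (leeD (IH _ H (@child_neq0 y _) (reduced_child _ ry) (past_below_child _ pH))
  (IH _ H (@child_neq0 y _) (reduced_child _ ry) (past_below_child _ pH))) _.
rewrite -ge0_integralD//; last 4 first.
- by move=> w _; rewrite mule_ge0.
- exact: emeasurable_funM.
- by move=> w _; rewrite mule_ge0.
- exact: emeasurable_funM.
have mT := measurable_turn_flow y; have mE := measurable_edge_flow y0.
have T0 := turn_flow_ge0.
(* The children carry the flow of [y] plus twice the turning flow. The latter has mean [flux]
   against [H], and [edge_discount_contract] absorbs the resulting [2 * flux]. *)
under eq_integral => w _.
  rewrite -ge0_muleDr// edge_flow_children// ge0_muleDr ?adde_ge0//.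
  rewrite ge0_muleDr//; over.
rewrite /= ge0_integralD//; last 4 first.
- by move=> w _; rewrite mule_ge0.
- exact: emeasurable_funM.
- by move=> w _; apply: adde_ge0; exact: mule_ge0.
- by apply: emeasurable_funD; exact: emeasurable_funM.
rewrite ge0_integralD//; last 4 first.
- by move=> w _; rewrite mule_ge0.
- exact: emeasurable_funM.
- by move=> w _; rewrite mule_ge0.
- exact: emeasurable_funM.
rewrite (integral_turn_flow ry pH).
rewrite (_ : flux%:E * _ + flux%:E * _ = (flux + flux)%:E * \int[P]_w H w); last first.
  by rewrite EFinD ge0_muleDl ?lee_fin ?flux_ge0.
rewrite -ge0_integralZl//; last first.
  by rewrite lee_fin addr_ge0 ?flux_ge0.
rewrite -ge0_integralD//; last 4 first.
- by move=> w _; rewrite mule_ge0.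
- exact: emeasurable_funM.
- by move=> w _; rewrite mule_ge0// lee_fin addr_ge0 ?flux_ge0.
- exact: measurable_funeM.
apply: ge0_le_integral => //.
- move=> w _; apply: adde_ge0; first exact: mule_ge0.
  by rewrite mule_ge0// lee_fin addr_ge0 ?flux_ge0.
- by apply: emeasurable_funD; [exact: emeasurable_funM|exact: measurable_funeM].
- exact: emeasurable_funM.
- move=> w _; rewrite [X in _ + X]muleC -ge0_muleDr ?lee_fin ?addr_ge0 ?flux_ge0//.
  rewrite /H -muleA lee_wpmul2l// (_ : flux + flux = 2 * flux)%R; last by ring.
  exact: edge_discount_contract.
Qed.


Lemma integral_edge_flow y : y <> [::] -> reduced y ->
  \int[P]_w edge_flow y w < +oo.
Proof.
move=> y0 ry; have mE k := measurable_edge_roads (2 ^+ k : R) y0.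
rewrite integral_nneseries//; last first.
  by move=> k; apply: measurable_funeM; exact: (measurable_npoints hPi (mE k)).
rewrite (eq_eseriesr (g := fun k => (2^-1 * ratio ^+ k)%:E)); last first.
  move=> k _; rewrite ge0_integralZl//; last 2 first.
  - exact: (measurable_npoints hPi (mE k)).
  - by move=> w _; exact: npoints_ge0.
  have nuE : 0 < intensity beta mu (edge_roads y (2 ^+ k)) < +oo.
    by rewrite intensity_edge_roads// ltry andbT lte_fin mulr_gt0 ?powR_gt0.
  have := integral_past_npoints hPi (mE k) nuE (past1 hPi (mE k)).
  have -> : \int[P]_w (cst 1 w * npts w (edge_roads y (2 ^+ k))) =
      \int[P]_w npts w (edge_roads y (2 ^+ k)).
    by apply: eq_integral => w _; rewrite mul1e.
  have -> : \int[P]_w cst 1 w = 1.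
    by rewrite integral_cst// mul1e; exact: probability_setT.
  move=> ->; rewrite mule1.
  by rewrite intensity_edge_roads// -EFinM level_rate.
by rewrite geometric_nneseries ?ratio_itv// ltry.
Qed.

(** Fatou's lemma: all expectations are bounded by that of [edge_flow y], so the limit inferior is
    integrable and almost surely finite. *)
Lemma discounted_flow_bounded y : y <> [::] -> reduced y ->
  {ae P, forall w, limn_einf (fun n => discounted_flow n y w) < +oo}.
Proof.
move=> y0 ry; pose u n w := discounted_flow n y w.
have u0 n w : 0 <= u n w by exact: discounted_flow_ge0.
have mu_ n : measurable_fun setT (u n) by exact: measurable_discounted_flow.
have l0 w : 0 <= limn_einf (u ^~ w).
  rewrite limn_einf_lim; apply: lime_ge; first exact: is_cvg_einfs.
  by apply: nearW => n; apply: le_ereal_inf_tmp => _ [k _ <-].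
have past1_below : past_below y (cst 1).
  by split => // z k _ _; apply: (past1 hPi); exact: measurable_turn_roads.
have il : \int[P]_w limn_einf (u ^~ w) < +oo.
  apply: le_lt_trans (integral_edge_flow y0 ry).
  apply: (le_trans (fatou P measurableT mu_ _)) => //.
  rewrite limn_einf_lim; apply: lime_le; first exact: is_cvg_einfs.
  apply: nearW => n; apply: ge_ereal_inf; exists (\int[P]_w u n w); first by exists n => //=.
  have := integral_discounted_flow n y0 ry past1_below.
  under eq_integral => w _ do rewrite /= mul1e.
  by under [in leRHS]eq_integral => w _ do rewrite /= mul1e.
have ml : measurable_fun setT (fun w => limn_einf (u ^~ w)).
  apply: measurableT_comp => //; apply: measurable_fun_limn_esup => n.
  exact: measurableT_comp.
have /(integrable_ae measurableT) : P.-integrable setT (fun w => limn_einf (u ^~ w)).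
  apply/integrableP; split => //.
  by under eq_integral => w _ do rewrite gee0_abs//.
by apply: filterS => w /(_ I); rewrite fin_numE ltey => /andP[].
Qed.

(** If [t] lies between 2^-(K + 1) and 2^-K, the latter excluded, then the edge carries a road of
    level [K], and its discount is at least exp(-2 flux / 2^K), where 2^-K is at most 2 t. *)
Lemma discount_time y w (t : R) : (0 < t < 1)%R ->
  edge_time Pi w (parent y) y <= t%:E ->
  (expR (- (4 * flux * t)))%:E <= edge_discount y w.
Proof.
move=> /andP[t0 t1] et.
have ex : exists K, (2 ^- K <= t)%R.
  exists (Num.truncn t^-1).+1; rewrite -[leRHS]invrK lef_pV2 ?posrE ?invr_gt0//.
  apply: le_trans (ltW (truncnS_gt _)) _.
  by rewrite -natrX ler_nat ltnW// ltn_expl.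
case: (ex_minnP ex) => -[|K]; first by rewrite expr0 invr1 leNgt t1.
move=> Kt Kmin; have tK : (t < 2 ^- K)%R.
  by rewrite ltNge; apply/negP => /Kmin; rewrite ltnn.
have hK : hit y w K.
  apply/mem_set; apply: (edge_time_lt (pow2_gt0 K)).
  by apply: le_lt_trans et _; rewrite lte_fin.
apply: le_trans (discount_series_ge flux_ge0 (@hit_decreasing y w) hK).
rewrite lee_fin ler_expR lerN2 (_ : 4 * flux * t = 2 * flux * (2 * t))%R; last by ring.
apply: ler_wpM2l; first by apply: mulr_ge0 => //; exact: flux_ge0.
by move: Kt; rewrite exprS invfM; move: (2 ^- K)%R => z; lra.
Qed.

(** Only the descendant on the path is kept; the discounts along the path multiply, so their
    exponents add up. *)
Lemma discounted_flow_path (y : nat -> vert) w (t : nat -> R) :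
  (forall n, exists i, y n.+1 = child (y n) i) -> (forall n, 0 < t n < 1)%R ->
  (forall n, edge_time Pi w (parent (y n)) (y n) <= (t n)%:E) ->
  forall n m, (expR (- (4 * flux * \sum_(i < n) t (m + i)%N)))%:E *
    edge_flow (y (m + n)%N) w <= discounted_flow n (y m) w.
Proof.
move=> ych t01 yt; elim=> [|n IH] m.
  by rewrite big_ord0 mulr0 oppr0 expR0 mul1e addn0.
rewrite big_ord_recl addn0 mulrDr opprD expRD EFinM -muleA /=.
apply: lee_pmul => //.
- by rewrite mule_ge0 ?lee_fin ?expR_ge0 ?edge_flow_ge0.
- exact: discount_time.
have := IH m.+1; rewrite addSnnS.
have -> : (\sum_(i < n) t (m.+1 + i)%N = \sum_(i < n) t (m + bump 0 i)%N)%R.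
  by apply: eq_bigr => i _; rewrite /bump leq0n add1n addSnnS.
move=> /le_trans; apply; case: (ych m) => i ->.
have : i = ord0 \/ i = ord_max.
  by case: i => [[|[|//]]] p; [left|right]; exact: val_inj.
by case=> ->; [apply: leeDl|apply: leeDr]; exact: discounted_flow_ge0.
Qed.

(** Summable times keep the product of the discounts along the path above a positive constant, while
    times tending to 0 drive [edge_flow] to infinity. *)
Lemma discounted_flow_cvgy w (x : nat -> vert) : root_geodesic x ->
  \sum_(n <oo) drive Pi w (x n) (x n.+1) < +oo ->
  exists m, discounted_flow n (x m.+1) w @[n --> \oo] --> +oo.
Proof.
move=> gx; under eq_eseriesr do rewrite (drive_root_geodesic _ _ _ gx).
set t := fun n => edge_time Pi w (parent (x n.+1)) (x n.+1) => toty.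
have t0 n : 0 <= t n by exact: edge_time_ge0.
have tfin n : t n \is a fin_num.
  rewrite ge0_fin_numE//; apply: le_lt_trans toty.
  apply: le_trans (nneseries_lim_ge (u_ := t) n.+1 _) => //.
  by rewrite big_nat_recr//=; apply: leeDr; apply: sume_ge0 => i _; exact: t0.
pose r n := fine (t n); have r0 n : (0 <= r n)%R by rewrite fine_ge0.
pose B := fine (\sum_(n <oo) t n).
have rB n : (\sum_(0 <= i < n) r i <= B)%R.
  rewrite -lee_fin -sumEFin fineK; last first.
    by rewrite ge0_fin_numE// nneseries_ge0.
  under eq_bigr do rewrite fineK//.
  exact: nneseries_lim_ge.
have rcvg : cvgn (series r).
  apply: nondecreasing_is_cvgn; first exact: nondecreasing_series.
  by exists B => _ [n _ <-]; exact: rB.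
have r_to0 := cvg_series_cvg_0 rcvg.
have small e : (0 < e)%R -> exists N, forall n, (N <= n)%N -> (r n < e)%R.
  move=> e0; move/cvgrPdist_lt : r_to0 => /(_ _ e0)[N _ hN].
  by exists N => n /hN; rewrite sub0r normrN ger0_norm.
have [N hN] := small (2^-1)%R ltac:(by rewrite invr_gt0).
pose m := N.+2; exists m.
(* [discount_time] asks for times strictly between 0 and 1: the added summands are positive, at most
   1/2 each and at most 1 in total, and the choice of [m] makes [r] less than 1/2. *)
pose tau n := (r (m + n)%N + 2 ^- n.+1 * 2^-1)%R.
have tau01 n : (0 < tau n < 1)%R.
  rewrite /tau ltr_wpDl ?mulr_gt0 ?invr_gt0//=.
  rewrite (@lt_le_trans _ _ (2^-1 + 2^-1)%R)//; last by lra.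
  apply: ltr_leD; first by apply: hN; rewrite /m; lia.
  by rewrite ler_piMl// invf_le1 ?exprn_ege1// ler1n.
pose y n := x (m + n).+1.
have ych n : exists i, y n.+1 = child (y n) i.
  by rewrite /y addnS; exact: root_geodesic_child.
have yt n : edge_time Pi w (parent (y n)) (y n) <= (tau n)%:E.
  by rewrite -[leLHS]/(t (m + n)%N) -(fineK (tfin _)) lee_fin lerDl mulr_ge0.
have tauB n : (\sum_(i < n) tau (0 + i)%N <= B + 1)%R.
  rewrite big_split/=; apply: lerD.
    apply: le_trans (rB (m + n)%N); rewrite -(big_mkord xpredT (fun i => r (m + i)%N)).
    rewrite [leRHS](big_cat_nat (n := m))//= ?leq_addr// -[X in (X <= _)%R]add0r lerD//.
      by rewrite sumr_ge0.
    rewrite -{2}[m]add0n big_addn addKn.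
    by under [leRHS]eq_bigr do rewrite addnC.
  have : forall n, (\sum_(i < n) 2 ^- i.+1 * 2^-1 <= 1 - 2 ^- n :> R)%R.
    elim=> [|k IH]; first by rewrite big_ord0 expr0 invr1 subrr.
    rewrite big_ord_recr/=; apply: le_trans (lerD IH (lexx _)) _.
    rewrite exprS invfM; have : (0 < 2 ^- k :> R)%R by rewrite invr_gt0.
    by move: (2 ^- k)%R => z z0; lra.
  by move=> /(_ n)/le_trans; apply; rewrite gerBl invr_ge0.
apply/cvgeyPge => A.
(* [c] bounds the product of discounts from below; a road of level [K] then suffices to exceed [A],
   and from [M] on every edge carries one. *)
pose c := expR (- (4 * flux * (B + 1))).
have c0 : (0 < c)%R by exact: expR_gt0.
have [K AK] : exists K, (A <= c * 2 ^+ K)%R.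
  exists (Num.truncn `|A / c|%R).+1; rewrite mulrC -ler_pdivrMr//.
  apply: le_trans (ler_norm _) _; apply: le_trans (ltW (truncnS_gt _)) _.
  by rewrite -natrX ler_nat ltnW// ltn_expl.
have [M hM] := small (2 ^- K)%R ltac:(by rewrite invr_gt0).
exists M => // n /= Mn.
have := discounted_flow_path ych tau01 yt n 0%N.
rewrite {2}/y add0n /y addn0 => /(le_trans _); apply.
apply: (@le_trans _ _ (c%:E * (2 ^+ K)%:E)); first by rewrite -EFinM lee_fin.
apply: lee_pmul; rewrite ?lee_fin ?expR_ge0 ?exprn_ge0//.
  rewrite ler_expR lerN2; apply: ler_wpM2l => //.
  by apply: mulr_ge0 => //; exact: flux_ge0.
apply: edge_flow_ge; apply/mem_set; apply: (edge_time_lt (pow2_gt0 K)).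
rewrite -[ltLHS]/(t (m + n)%N) -(fineK (tfin _)) lte_fin.
by apply: hM; apply: leq_trans Mn _; exact: leq_addl.
Qed.

End supercritical.

(** * The case beta < 2 *)

Lemma null_of_geometric {R : realType} {d} {T : measurableType d}
    (mu : {measure set T -> \bar R}) (N : set T) (c x : R) : (0 <= x < 1)%R ->
  (forall k, mu N <= (c * x ^+ k)%:E) -> mu N = 0.
Proof.
move=> /andP[x0 x1] h; apply/eqP; rewrite eq_le measure_ge0 andbT.
have xk : (c * x ^+ k)%:E @[k --> \oo] --> 0.
  apply: cvg_EFin; first exact: nearW.
  rewrite -[X in _ --> X](mulr0 c); apply: cvgMr.
  by apply: cvg_expr; rewrite ger0_norm.
rewrite -(cvg_lim _ xk)//; apply: lime_ge; last exact: nearW.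
by apply/cvg_ex; exists 0.
Qed.

Lemma ae_forall_countable {R : realType} {d} {T : measurableType d}
    (mu : {measure set T -> \bar R}) {I : countType} (Q : I -> T -> Prop) :
  (forall i, {ae mu, forall w, Q i w}) -> {ae mu, forall w, forall i, Q i w}.
Proof.
move=> h; have : {ae mu, forall w n, oapp (Q^~ w) True (choice.unpickle n)}.
  apply/ae_foralln => n; case: (choice.unpickle n) => [i|]; first exact: h.
  by apply: aeW.
by apply: filterS => w hw i; have := hw (choice.pickle i); rewrite choice.pickleK.
Qed.

Lemma root_geodesic_of_children (x : nat -> vert) : x 0%N = Defs.root ->
  (forall n, exists i, x n.+1 = child (x n) i) -> root_geodesic x.
Proof.
move=> x0 ch; have rx n : reduced (x n).
  elim: n => [|n IH]; first by rewrite x0.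
  by case: (ch n) => i ->; exact: reduced_child.
have sx n : size (x n) = n.
  elim: n => [|n IH]; first by rewrite x0.
  by case: (ch n) => i ->; rewrite size_rcons IH.
have px m k : prefix (x m) (x (m + k)%N).
  elim: k => [|k IH]; first by rewrite addn0 prefix_refl.
  rewrite addnS; case: (ch (m + k)%N) => i ->.
  by apply: prefix_trans IH _; exact: prefix_rcons.
split => //; split => // m n; have [mn|/ltnW mn] := leqP m n.
  by have := px m (n - m)%N; rewrite subnKC// => /dist_prefix->; rewrite !sx.
by have := px n (m - n)%N; rewrite subnKC// distC => /dist_prefix->; rewrite !sx.
Qed.

(** * Greedy exploration along faster and faster roads *)

Section subcritical.
Context {R : realType} {beta : R} (hbeta1 : (1 < beta)%R).
Context {mu : {measure set lineM -> \bar R}}.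
Hypothesis hmu : forall x y : vert, reduced x -> reduced y -> x <> y ->
  mu (thru x y) = ((2 ^- dist x y)%R)%:E.
Context {d : measure_display} {Omega : measurableType d} (P : probability Omega R)
  (Pi : Omega -> set (lineM * R)).
Hypothesis hPi : poisson_process P Pi (intensity beta mu).
Local Notation npts := (@npoints R Omega (lineM * R)%type Pi).
Local Notation vacant := (@vacant R _ _ Omega (lineM * R)%type Pi).
Local Notation past_below := (@past_below R _ Omega P Pi).

Definition edge_growth : R := (2 `^ (beta - 1))%R.

Lemma edge_growth_gt1 : (1 < edge_growth)%R.
Proof.
rewrite -[ltLHS](powRr0 2) /edge_growth /powR pnatr_eq0/= ltr_expR mul0r.
by rewrite mulr_gt0 ?ln_gt0 ?ltr1n// subr_gt0.
Qed.

Lemma edge_growth_gt0 : (0 < edge_growth)%R.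
Proof. exact: lt_trans edge_growth_gt1. Qed.

Lemma powR_pow2 k : ((2 ^+ k : R) `^ (1 - beta) = edge_growth ^- k)%R.
Proof.
have e : (2 ^+ k = 2 `^ k%:R :> R)%R by rewrite powR_mulrn.
rewrite -powR_invn ?powR_ge0// /edge_growth e -!powRrM.
by congr powR; ring.
Qed.

Lemma powR_pow2V k : ((2 ^- k : R) `^ (1 - beta) = edge_growth ^+ k)%R.
Proof.
have e : (2 ^- k = 2 `^ (- k%:R) :> R)%R by rewrite powR_invn.
rewrite -powR_mulrn ?powR_ge0// /edge_growth e -!powRrM.
by congr powR; ring.
Qed.

Lemma expRN_le_inv (x : R) : (0 < x)%R -> (expR (- x) <= x^-1)%R.
Proof.
move=> x0; rewrite expRN lef_pV2 ?posrE ?expR_gt0//.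
by apply: le_trans (expR_ge1Dx x); rewrite lerDr.
Qed.

(** An infinite time means vacancy at every speed 2^-k, where the rate grows like
    [edge_growth ^+ k]. The result serves the finitely many edges before the exploration reaches a
    road. *)
Lemma edge_time_finite y : y <> [::] -> reduced y ->
  {ae P, forall w, edge_time Pi w (parent y) y < +oo}.
Proof.
move=> y0 ry; have s0 k : (0 < 2 ^- k :> R)%R by rewrite invr_gt0 exprn_gt0.
have mE k := measurable_edge_roads (2 ^- k : R)%R y0.
exists (\bigcap_k vacant (edge_roads y (2 ^- k)%R)); split.
- by apply: bigcapT_measurable => k; exact: (measurable_vacant hPi (mE k)).
- apply: (@null_of_geometric _ _ _ _ _ 2 edge_growth^-1).
    by rewrite invr_ge0 (ltW edge_growth_gt0)/= invf_lt1 ?edge_growth_gt1// edge_growth_gt0.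
  move=> k; apply: (@le_trans _ _ (P (vacant (edge_roads y (2 ^- k)%R)))).
    apply: le_measure; [apply/mem_set|apply/mem_set|].
    + by apply: bigcapT_measurable => j; exact: (measurable_vacant hPi (mE j)).
    + exact: (measurable_vacant hPi (mE k)).
    + by move=> w; apply.
  have nuE : intensity beta mu (edge_roads y (2 ^- k)%R) =
      (2^-1 * edge_growth ^+ k)%:E by rewrite intensity_edge_roads// powR_pow2V.
  have g0 : (0 < 2^-1 * edge_growth ^+ k)%R.
    by rewrite mulr_gt0// exprn_gt0// edge_growth_gt0.
  rewrite (prob_vacant hPi (mE k)) nuE ?lte_fin ?g0 ?ltry//= lee_fin.
  apply: le_trans (expRN_le_inv g0) _.
  by rewrite invfM invrK exprVn.
- move=> w /= /negP; rewrite -leNgt leye_eq => /eqP et k _.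
  apply: contrapT => nk; have := edge_time_le (s0 k) nk.
  by rewrite et leye_eq.
Qed.

Definition turns (y : vert) (k : nat) : set Omega :=
  ~` vacant (turn_roads y (2 ^+ k)).

Definition covered (y : vert) (k : nat) : set Omega :=
  ~` vacant (edge_roads y (2 ^+ k)).

(** The probability that no road of level [k] turns at a given vertex. *)
Definition miss (k : nat) : R := expR (- (4^-1 * edge_growth ^- k)).

Lemma miss_itv k : (0 < miss k <= 1)%R.
Proof.
rewrite expR_gt0 -[leRHS]expR0 ler_expR oppr_le0 mulr_ge0//.
by rewrite invr_ge0 exprn_ge0// ltW// edge_growth_gt0.
Qed.

Lemma integral_vacant_turn y k G : reduced y -> past_below y G ->
  \int[P]_(w in vacant (turn_roads y (2 ^+ k))) G w = (miss k)%:E * \int[P]_w G w.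
Proof.
move=> ry [_ pG]; have mT := measurable_turn_roads y (2 ^+ k : R)%R.
have k0 : (0 < 2 ^+ k :> R)%R by rewrite exprn_gt0.
transitivity (P (vacant (turn_roads y (2 ^+ k)%R)) * \int[P]_w G w).
  exact: (past_base 0%N (pG y k (prefix_refl y) ry)).
congr (_ * _).
have nuT : intensity beta mu (turn_roads y (2 ^+ k)%R) =
  (4^-1 * edge_growth ^- k)%:E by rewrite intensity_turn_roads// powR_pow2.
have := prob_vacant hPi mT; rewrite nuT => ->//.
rewrite lte_fin ltry andbT mulr_gt0// invr_gt0 exprn_gt0// edge_growth_gt0//.
Qed.

(** All roads in [B] pass through [y], a proper ancestor of every vertex at or below [child y i];
    observing whether [B] is hit leaves the turns there independent. *)
Lemma past_below_restrict y i G (B : set (lineM * R)) b :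
  past_below (child y i) G ->
  measurable B ->
  (forall p, B p -> lset p.1 y) ->
  past_below (child y i) (G \_ (if b then ~` vacant B else vacant B)).
Proof.
move=> [fG pG] mB hB; split.
  by move=> w; rewrite patchE; case: ifP.
move=> z k yz rz; have mT := measurable_turn_roads z (2 ^+ k : R)%R.
have TB : turn_roads z (2 ^+ k)%R `&` B = set0.
  apply: turn_roads_disjoint => p /hB py; exists y; split => //.
    by apply: prefix_trans yz; exact: prefix_rcons.
  by move=> e; have := size_prefix yz; rewrite /child size_rcons -e ltnn.
by case: b; [apply: (past_hits hPi)|apply: (past_vacant hPi)] => //; exact: pG.
Qed.

Variable budget : nat -> nat.

(* A greedy exploration: [k] is the level of the road that is being followed,
   [j] the number of further edges along which it may be followed before a road
   of level [k.+1] has to turn at the current vertex.  [stuck n y k j] is the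
   event that this fails within [n] steps. *)
Fixpoint stuck (n : nat) (y : vert) (k j : nat) : set Omega :=
  if n is n'.+1 then
    (turns y k.+1 `&` stuck n' (child y ord0) k.+1 (budget k.+1)) `|`
    (vacant (turn_roads y (2 ^+ k.+1)) `&`
      if j is j'.+1 then
        (covered (child y ord0) k `&` stuck n' (child y ord0) k j') `|`
        (vacant (edge_roads (child y ord0) (2 ^+ k)) `&`
           stuck n' (child y ord_max) k j')
      else setT)
  else set0.

Lemma measurable_vacant_turn y k : measurable (vacant (turn_roads y (2 ^+ k))).
Proof. exact: (measurable_vacant hPi (measurable_turn_roads _ _)). Qed.

Lemma measurable_vacant_edge y i k :
  measurable (vacant (edge_roads (child y i) (2 ^+ k))).
Proof.
exact: (measurable_vacant hPi (measurable_edge_roads _ (@child_neq0 y i))).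
Qed.

Lemma measurable_stuck n y k j : measurable (stuck n y k j).
Proof.
elim: n y k j => [|n IH] y k j //=.
have mT := measurable_vacant_turn y k.+1; have mE := measurable_vacant_edge y ord0 k.
apply: measurableU; apply: measurableI => //; first exact: measurableC.
case: j => // j; apply: measurableU; apply: measurableI => //.
exact: measurableC.
Qed.

Lemma stuck_nondecreasing n y k j : stuck n y k j `<=` stuck n.+1 y k j.
Proof.
elim: n y k j => [|n IH] y k j w; first by [].
move=> [[tw sw]|[vw sw]].
  by left; split => //; exact: IH.
right; split => //; case: j sw => // j [[cw sw]|[cw sw]].
  by left; split => //; exact: IH.
by right; split => //; exact: IH.
Qed.

(** [fail k] stands for a bound on the probability of ever getting stuck when level [k] starts with
    its full budget. In the recursion, the power covers [(budget k).+1] missing turns in a row, and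
    [fail k.+1] all higher levels. *)
Variable fail : nat -> R.
Hypothesis fail_ge0 : forall k, (0 <= fail k)%R.
Hypothesis fail_step : forall k,
  (miss k.+1 ^+ (budget k).+1 + fail k.+1 <= fail k)%R.

(** With m the miss probability and f the failure bound of the next level, one step gives (1 - m) f
    + m (m^j + f) = m^(j + 1) + f: a turn hands over to the next level, its absence costs one unit
    of budget. *)
Lemma integral_stuck n y k j G : reduced y -> past_below y G ->
  \int[P]_(w in stuck n y k j) G w <=
    (miss k.+1 ^+ j.+1 + fail k.+1)%:E * \int[P]_w G w.
Proof.
have miss0 i : (0 <= miss i)%R by case/andP: (miss_itv i) => /ltW.
elim: n y k j G => [|n IH] y k j G ry pG.
  have G0 w := past_below_ge0 w pG ry.
  rewrite integral_set0 mule_ge0 ?integral_ge0// lee_fin addr_ge0//.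
  exact: exprn_ge0.
have mG := past_below_measurable pG ry; have G0 w := past_below_ge0 w pG ry.
have mT := measurable_vacant_turn y k.+1; have mE := measurable_vacant_edge y ord0 k.
have mS := measurable_stuck n.
have iGoo : \int[P]_w G w < +oo.
  by case: pG => _ /(_ y 0%N (prefix_refl y) ry)[].
have iG : \int[P]_w G w \is a fin_num by rewrite ge0_fin_numE ?integral_ge0.
have yturn p : turn_roads y (2 ^+ k.+1 : R)%R p -> lset p.1 y.
  by move=> [/= [L0 L1] _]; exact: (@line_between _ y ord0 ord_max).
have yedge p : edge_roads (child y ord0) (2 ^+ k : R)%R p -> lset p.1 y.
  by move=> [/= []]; rewrite /child parent_rcons.
have fV := integral_restrict_fin mT mG G0 (iGoo).
have split_integral (H : Omega -> \bar R) (D : set Omega) : measurable D ->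
    measurable_fun setT H -> (forall w, 0 <= H w) ->
    \int[P]_(w in ~` D) H w + \int[P]_(w in D) H w = \int[P]_w H w.
  move=> mD mH H0; rewrite -ge0_integral_setU ?setvU//.
  - exact: measurableC.
  - by rewrite disj_set2E setICl.
have eT : \int[P]_(w in turns y k.+1) G w = (1 - miss k.+1)%:E * \int[P]_w G w.
  have := split_integral G _ mT mG G0; rewrite -/(turns y k.+1) => e.
  rewrite -[LHS](addeK _ fV) e (integral_vacant_turn k.+1 ry pG).
  by rewrite -(fineK iG) -!EFinM -EFinB; congr (_%:E); ring.
have pT i b := past_below_restrict b (past_below_child i pG)
  (measurable_turn_roads y _) yturn.
have first_le : \int[P]_(w in turns y k.+1 `&`
    stuck n (child y ord0) k.+1 (budget k.+1)) G w <=
    (fail k.+1 * (1 - miss k.+1))%:E * \int[P]_w G w.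
  rewrite setIC integral_mkcondr.
  apply: le_trans (IH _ _ _ _ (reduced_child _ ry) (pT ord0 true)) _.
  rewrite -integral_mkcond eT EFinM -muleA lee_wpmul2r ?lee_fin//.
  by rewrite mule_ge0 ?integral_ge0// lee_fin subr_ge0; case/andP: (miss_itv k.+1).
apply: (@le_trans _ _ ((fail k.+1 * (1 - miss k.+1))%:E * \int[P]_w G w +
    (miss k.+1 * (miss k.+1 ^+ j + fail k.+1))%:E * \int[P]_w G w)); last first.
  rewrite -(fineK iG) -!EFinM -EFinD lee_fin -mulrDl ler_wpM2r//.
    by rewrite fine_ge0 ?integral_ge0.
  by rewrite exprS; lra.
rewrite /= ge0_integral_setU//; last 4 first.
- by apply: measurableI => //; exact: measurableC.
- apply: measurableI => //; case: j => // j; apply: measurableU; apply: measurableI => //.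
  exact: measurableC.
- exact: measurable_funTS.
- by rewrite disj_set2E /turns setIACA setICl set0I.
apply: leeD => //; case: j => [|j].
  rewrite setIT (integral_vacant_turn k.+1 ry pG) lee_wpmul2r ?integral_ge0//.
  by rewrite lee_fin expr0 ler_peMr// lerDl.
rewrite setIC integral_mkcondr.
have mGT : measurable_fun setT (G \_ (vacant (turn_roads y (2 ^+ k.+1)))).
  by apply/(measurable_restrictT _ mT); exact: measurable_funTS.
have GT0 w : 0 <= (G \_ (vacant (turn_roads y (2 ^+ k.+1)))) w.
  exact: erestrict_ge0.
have pE i b := past_below_restrict b (pT i false)
  (measurable_edge_roads _ (@child_neq0 y ord0)) yedge.
rewrite ge0_integral_setU//; last 4 first.
- by apply: measurableI => //; exact: measurableC.
- exact: measurableI.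
- exact: measurable_funTS.
- by rewrite disj_set2E /covered setIACA setICl set0I.
rewrite ![_ `&` stuck _ _ _ _]setIC !integral_mkcondr.
(* The two continuations have the same bound, and their weights add up to the weight restricted to
   no turn at [y]. *)
apply: le_trans (leeD (IH _ _ _ _ (reduced_child _ ry) (pE ord0 true))
  (IH _ _ _ _ (reduced_child _ ry) (pE ord_max false))) _.
rewrite -ge0_muleDr ?integral_ge0//; last 2 first.
- by move=> w _; exact: erestrict_ge0.
- by move=> w _; exact: erestrict_ge0.
rewrite -!integral_mkcond split_integral// -integral_mkcond.
rewrite (integral_vacant_turn k.+1 ry pG) muleA -EFinM.
by rewrite mulrC exprS.
Qed.


Lemma prob_stuck y k : reduced y ->
  P (\bigcup_n stuck n y k (budget k)) <= (fail k)%:E.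
Proof.
move=> ry; have mS n := measurable_stuck n y k (budget k).
have nd : nondecreasing_seq (fun n => stuck n y k (budget k)).
  by apply/nondecreasing_seqP => n; apply/subsetPset; exact: stuck_nondecreasing.
have cv := nondecreasing_cvg_mu (mu := P) mS (bigcupT_measurable _ mS) nd.
rewrite -(cvg_lim _ cv)//; apply: lime_le; first by apply/cvg_ex; eexists; exact: cv.
apply: nearW => n /=.
have past1_below : past_below y (cst 1).
  by split => // z j _ _; apply: (past1 hPi); exact: measurable_turn_roads.
have := integral_stuck n k (budget k) ry past1_below.
rewrite !integral_cst// !mul1e => /le_trans; apply.
by rewrite [X in _ * X]probability_setT mule1 lee_fin.
Qed.

Definition step (w : Omega) (s : vert * nat * nat) : vert * nat * nat :=
  let: (y, k, j) := s in
  if w \in turns y k.+1 then (child y ord0, k.+1, budget k.+1)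
  else (child y (if w \in covered (child y ord0) k then ord0 else ord_max), k, j.-1).

Definition free (w : Omega) (s : vert * nat * nat) : Prop :=
  forall n, ~ stuck n s.1.1 s.1.2 s.2 w.

(** The edge above the current vertex carries a road of the current level. The root has no such
    edge, so the exploration acquires this property only later. *)
Definition on_road (w : Omega) (s : vert * nat * nat) : Prop :=
  s.1.1 <> [::] /\ covered s.1.1 s.1.2 w.

Lemma free_turns w y k : free w (y, k, 0%N) -> w \in turns y k.+1.
Proof.
by move=> /(_ 1%N) h; apply/mem_set => v; apply: h; right.
Qed.

Lemma notin_turns w y k : w \in turns y k = false ->
  vacant (turn_roads y (2 ^+ k)) w.
Proof. by move=> h; apply: contrapT => nv; rewrite mem_set in h. Qed.

Lemma notin_covered w y k : w \in covered y k = false ->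
  vacant (edge_roads y (2 ^+ k)) w.
Proof. by move=> h; apply: contrapT => nv; rewrite mem_set in h. Qed.

Lemma free_step w s : free w s -> free w (step w s).
Proof.
case: s => [[y k] j] h; rewrite /step; case: ifPn => [tw|/negbTE tw].
  by move=> n sn; apply: (h n.+1); left; split => //; exact: set_mem.
case: j h => [/free_turns|j h]; first by rewrite tw.
case: ifPn => [cw|/negbTE cw] n sn; apply: (h n.+1); right;
  (split; first exact: notin_turns).
  by left; split => //; exact: set_mem.
by right; split => //; exact: notin_covered.
Qed.

Lemma step_child w s : exists i, (step w s).1.1 = child s.1.1 i.
Proof. by case: s => [[y k] j] /=; case: ifP => _ /=; eexists. Qed.

Lemma coveredP w y k (L : line) v : Pi w (L, v) -> lset L (parent y) -> lset L y ->
  (2 ^+ k <= v)%R -> covered y k w.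
Proof.
move=> PL Lp Ly kv /npoints_eq0/(_ _ PL); apply.
by split => //=; rewrite in_itv/= andbT.
Qed.

Lemma turns_covered w y k : turns y k w -> covered (child y ord0) k w.
Proof.
move=> tw /npoints_eq0 h; apply: tw; apply/npoints_eq0 => -[L v] PL [[/= L0 L1] kv].
apply: (h _ PL); split => //; split => //; rewrite /child parent_rcons.
exact: (@line_between L y ord0 ord_max).
Qed.

(** At a turn, the new road uses the edge to [child y ord0]. Otherwise the current road leaves [y]
    through one of its children: if the first is not covered, the second is. *)
Lemma on_road_step w s : on_road w s -> on_road w (step w s).
Proof.
case: s => [[y k] j] [/= y0 cw]; split.
  by have [i ->] := step_child w (y, k, j); exact: child_neq0.
rewrite /step; case: ifPn => [/set_mem|_]; first exact: turns_covered.
case: ifPn => [/set_mem//|/negbTE/notin_covered vw] /=.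
move=> vw1; apply: cw; apply/npoints_eq0 => -[L v] PL [[/= Lp Ly]].
rewrite in_itv/= andbT => kv.
have py i : lset L (child y i) -> covered (child y i) k w.
  by move=> Li; apply: (coveredP PL) => //; rewrite /child parent_rcons.
by have [[_ /py]|[_ /py]|[/py]] := line_two_neighbors y0 Ly.
Qed.

(** A free state meets a turn by the time its budget is spent, and the edge taken at a turn is
    covered. *)
Lemma free_on_road w s : free w s -> exists n, on_road w (iter n (step w) s).
Proof.
case: s => [[y k] j]; elim: j y => [|j IH] y h.
  exists 1%N; rewrite /= free_turns//; split; first exact: child_neq0.
  by apply: turns_covered; apply/set_mem; exact: free_turns.
have [tw|/negbTE tw] := boolP (w \in turns y k.+1).
  exists 1%N; rewrite /= tw; split; first exact: child_neq0.
  by apply: turns_covered; exact: set_mem.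
have := free_step h; rewrite {1}/step tw => /IH[n hn].
by exists n.+1; rewrite iterSr /step tw.
Qed.

(** [reserve k] stands for a bound on the time spent at levels above [k]. Level [k.+1] uses at most
    [(budget k.+1).+1] edges, the extra one being the edge taken at the turn. *)
Variable reserve : nat -> R.
Hypothesis reserve_ge0 : forall k, (0 <= reserve k)%R.
Hypothesis reserve_step : forall k,
  ((budget k.+1).+1%:R * 2 ^- k.+1 + reserve k.+1 <= reserve k)%R.

(* A bound for the driving time along the remainder of the exploration. *)
Definition potential (s : vert * nat * nat) : R :=
  (s.2%:R * 2 ^- s.1.2 + reserve s.1.2)%R.

Lemma potential_ge0 s : (0 <= potential s)%R.
Proof. by rewrite addr_ge0// mulr_ge0// invr_ge0 exprn_ge0. Qed.

(** Without a turn, one unit of budget pays for the edge, and freeness ensures that one is left. At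
    a turn, the reserve pays for the edge and for the new budget. *)
Lemma time_step w s : free w s -> on_road w s ->
  edge_time Pi w (parent (step w s).1.1) (step w s).1.1 +
    (potential (step w s))%:E <= (potential s)%:E.
Proof.
move=> fs os; have [s0 cs] := on_road_step os.
have k0 : (0 < 2 ^+ (step w s).1.2 :> R)%R by rewrite exprn_gt0.
apply: le_trans (leeD (edge_time_le k0 cs) (lexx _)) _; rewrite -EFinD lee_fin.
case: s fs {os s0 cs k0} => [[y k] j] fs; rewrite /step /potential.
case: ifPn => [_|/negbTE tw] /=.
  apply: (@le_trans _ _ (reserve k)); last first.
    by rewrite lerDr mulr_ge0// invr_ge0 exprn_ge0.
  apply: le_trans (reserve_step k).
  by rewrite -[in leRHS](natr1 (budget k.+1)) [in leRHS]mulrDl mul1r; lra.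
case: j fs => [/free_turns|j _]; first by rewrite tw.
by rewrite /= -(natr1 j) [in leRHS]mulrDl mul1r; lra.
Qed.

(** Finitely many edges precede the first road; from then on the times telescope against
    [potential]. *)
Lemma free_path w K j :
  (forall y, y <> [::] -> reduced y -> edge_time Pi w (parent y) y < +oo) ->
  free w (Defs.root, K, j) ->
  exists x, root_geodesic x /\ \sum_(n <oo) drive Pi w (x n) (x n.+1) < +oo.
Proof.
move=> fin_time fr; pose s n := iter n (step w) (Defs.root, K, j).
have fs n : free w (s n) by elim: n => //= n IH; exact: free_step.
pose x n := (s n).1.1; have gx : root_geodesic x.
  by apply: root_geodesic_of_children => // n; exact: step_child.
exists x; split => //; under eq_eseriesr do rewrite (drive_root_geodesic _ _ _ gx).
pose t n := edge_time Pi w (parent (x n.+1)) (x n.+1).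
have t0 n : 0 <= t n by exact: edge_time_ge0.
have [N hN] := free_on_road fr.
have rN n : on_road w (s (n + N)%N).
  by elim: n => [//|n IH]; exact: on_road_step.
change (\sum_(n <oo) t n < +oo).
rewrite (nneseries_split 0 N)// add0n.
apply: lte_add_pinfty.
  rewrite -(fineK (x := \sum_(0 <= k < N) t k)) ?ltry//.
  apply/sum_fin_numP => n _ _; rewrite ge0_fin_numE//; apply: fin_time.
    exact: root_geodesic_neq0.
  by case: gx => _ [rx _]; exact: rx.
rewrite -nneseries_addn//; apply: le_lt_trans (ltry (potential (s N))).
apply: nneseries_le => // n.
suff : \sum_(0 <= k < n) t (k + N)%N + (potential (s (n + N)%N))%:E <= (potential (s N))%:E.
  by apply: le_trans; rewrite leeDl// lee_fin potential_ge0.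
elim: n => [|n IH]; first by rewrite big_geq// add0e.
rewrite big_nat_recr//= -addeA; apply: le_trans IH; rewrite leeD2l//.
exact: (time_step (fs _) (rN n)).
Qed.

End subcritical.

(** * Budgets and geometric bounds for beta < 2 *)

Section subcritical_parameters.
Context {R : realType} {beta : R} (hbeta1 : (1 < beta)%R) (hbeta2 : (beta < 2)%R).

(** The exponent [beta / 2] lies strictly between [beta - 1] and 1 when [beta < 2]: budgets outgrow
    the waiting time for a turn but grow more slowly than the speeds. *)
Definition budget_growth : R := (2 `^ (beta / 2))%R.

Let a : R := edge_growth (beta := beta).
Let b := budget_growth.

Let ln2_gt0 : (0 < ln 2 :> R)%R. Proof. by rewrite ln_gt0// ltr1n. Qed.

Let bE : b = expR (beta / 2 * ln 2)%R.
Proof. by rewrite /b /budget_growth /powR pnatr_eq0. Qed.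

Let aE : a = expR ((beta - 1) * ln 2)%R.
Proof. by rewrite /a /edge_growth /powR pnatr_eq0. Qed.

Lemma budget_growth_itv : (1 < b < 2)%R.
Proof.
have beta0 : (0 < beta / 2)%R by apply: divr_gt0 => //; exact: lt_trans hbeta1.
have beta1 : (beta / 2 < 1)%R by rewrite ltr_pdivrMr// mul1r.
rewrite bE; apply/andP; split.
  by rewrite -[ltLHS]expR0 ltr_expR mulr_gt0.
by rewrite -[ltRHS](@lnK _ 2%R) ?posrE// ltr_expR gtr_pMl.
Qed.

Lemma edge_growth_lt : (a < b)%R.
Proof.
rewrite aE bE ltr_expR ltr_pM2r// ltr_pdivlMr// -subr_gt0.
by rewrite (_ : beta - (beta - 1) * 2 = 2 - beta)%R ?subr_gt0//; ring.
Qed.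

Let b0 : (0 < b)%R. Proof. by case/andP: budget_growth_itv => h _; lra. Qed.
Let a0 : (0 < a)%R. Proof. exact: edge_growth_gt0. Qed.

Definition growth_budget (k : nat) : nat := (Num.truncn (b ^+ k)).+1.

(** Tails of geometric series: 4 a (a / b)^k bounds the chance of exhausting the budget of level
    [k], and 3 (b / 2)^(k + 1), in [growth_reserve], the time spent at level [k.+1]. *)
Definition growth_fail (k : nat) : R := (4 * a / (1 - a / b) * (a / b) ^+ k)%R.

Definition growth_reserve (k : nat) : R := (3 / (1 - b / 2) * (b / 2) ^+ k.+1)%R.

Lemma ab_itv : (0 <= a / b < 1)%R.
Proof. by rewrite divr_ge0 ?ltW//= ltr_pdivrMr// mul1r edge_growth_lt. Qed.

Lemma growth_fail_ge0 k : (0 <= growth_fail k)%R.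
Proof.
case/andP: ab_itv => ab0 ab1; rewrite mulr_ge0 ?exprn_ge0// divr_ge0 ?mulr_ge0 ?ltW//.
by rewrite subr_gt0.
Qed.

Lemma growth_fail_step k :
  (miss (beta := beta) k.+1 ^+ (growth_budget k).+1 + growth_fail k.+1 <= growth_fail k)%R.
Proof.
case/andP: ab_itv => ab0 ab1.
have e : (growth_fail k = 4 * a * (a / b) ^+ k + growth_fail k.+1)%R.
  rewrite /growth_fail exprS; have h : (1 - a / b != 0)%R by rewrite subr_eq0 gt_eqF.
  move: (_ ^+ k)%R h => z h; field; rewrite ?(gt_eqF b0)//.
  by rewrite subr_eq0 gt_eqF// edge_growth_lt.
rewrite e lerD2r /miss -expRM_natl mulrN -/a.
have g0 : (0 < (growth_budget k).+1%:R * (4^-1 * a ^- k.+1))%R.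
  by rewrite !mulr_gt0// ?invr_gt0 ?exprn_gt0.
(* exp(-x) is at most 1 / x, and here x is at least b^k / (4 a^(k + 1)). *)
apply: le_trans (expRN_le_inv g0) _.
have -> : (4 * a * (a / b) ^+ k = (b ^+ k * (4^-1 * a ^- k.+1))^-1)%R.
  by rewrite expr_div_n exprS !invfM !invrK; ring.
rewrite lef_pV2 ?posrE ?mulr_gt0 ?invr_gt0 ?exprn_gt0//.
rewrite ler_pM2r ?mulr_gt0 ?invr_gt0 ?exprn_gt0//.
by apply: le_trans (ltW (truncnS_gt _)) _; rewrite ler_nat.
Qed.

Lemma growth_reserve_ge0 k : (0 <= growth_reserve k)%R.
Proof.
case/andP: budget_growth_itv => b1 b2.
by rewrite mulr_ge0 ?exprn_ge0// ?divr_ge0// ?subr_ge0; lra.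
Qed.

Lemma growth_reserve_step k :
  ((growth_budget k.+1).+1%:R * 2 ^- k.+1 + growth_reserve k.+1 <= growth_reserve k)%R.
Proof.
case/andP: budget_growth_itv => b1 b2.
have e : (growth_reserve k = 3 * (b / 2) ^+ k.+1 + growth_reserve k.+1)%R.
  rewrite /growth_reserve [((b / 2) ^+ k.+2)%R]exprS; move: (_ ^+ k.+1)%R => z.
  by field; rewrite subr_eq0 gt_eqF.
rewrite e lerD2r expr_div_n mulrA ler_wpM2r ?invr_ge0 ?exprn_ge0//.
(* The constant 3: the number of edges is at most b^(k + 1) + 2, hence at most 3 b^(k + 1). *)
have bk : (1 <= b ^+ k.+1)%R by rewrite exprn_ege1// ltW.
have -> : ((growth_budget k.+1).+1%:R = (Num.truncn (b ^+ k.+1))%:R + 2 :> R)%R.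
  by rewrite /growth_budget -addn2 natrD.
have : ((Num.truncn (b ^+ k.+1))%:R <= b ^+ k.+1)%R by rewrite truncn_le ltW// exprn_gt0.
lra.
Qed.

End subcritical_parameters.

Theorem theorem2 (R : realType) (beta : R) (hbeta : (1 < beta)%R)
  (mu : {measure set lineM -> \bar R})
  (hmu : forall x y : vert, reduced x -> reduced y -> x <> y ->
           mu (thru x y) = ((2 ^- dist x y)%R)%:E)
  (d : measure_display) (Omega : measurableType d) (P : probability Omega R)
  (Pi : Omega -> set (lineM * R))
  (hPi_pos : forall om, Pi om `<=` [set p | (0 < p.2)%R])
  (hPi : poisson_process P Pi (intensity beta mu)) :
  ((beta < 2)%R ->
     {ae P, forall om, exists x : nat -> vert, root_geodesic x /\
        \sum_(0 <= n <oo) drive Pi om (x n) (x n.+1) < +oo}) /\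
  ((2 < beta)%R ->
     {ae P, forall om, forall x : nat -> vert, root_geodesic x ->
        \sum_(0 <= n <oo) drive Pi om (x n) (x n.+1) = +oo}).
Proof.
split=> hbeta2.
  pose bud := growth_budget (beta := beta); pose fl := growth_fail (beta := beta).
  (* Failure of the exploration started at the root with level [K]. Its probability tends to 0 as
     [K] grows, so almost surely some starting level succeeds. *)
  pose bad K := \bigcup_n stuck Pi bud n [::] K (bud K).
  have mbad K : measurable (bad K).
    by apply: bigcupT_measurable => n; exact: (measurable_stuck hPi).
  have badE K : P (bad K) <= (fl K)%:E.
    apply: (prob_stuck hbeta hmu hPi) => //.
    - exact: growth_fail_ge0.
    - exact: growth_fail_step.
  have bad0 : {ae P, forall w, ~ (\bigcap_K bad K) w}.
    exists (\bigcap_K bad K); split; first exact: bigcapT_measurable.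
    - apply: null_of_geometric (ab_itv hbeta hbeta2) _ => K.
      apply: le_trans (badE K); apply: le_measure; last exact: bigcap_inf.
        by apply/mem_set; exact: bigcapT_measurable.
      exact/mem_set.
    - by move=> w /contrapT.
  have fin_time : {ae P, forall w y, y <> [::] -> reduced y ->
      edge_time Pi w (parent y) y < +oo}.
    apply: ae_forall_countable => y.
    have [y0|y0] := eqVneq y [::]; first by apply: aeW => w /(_ y0).
    have [ry|ry] := boolP (reduced y); last by apply: aeW.
    have := edge_time_finite hbeta hmu hPi (elimN eqP y0) ry.
    by apply: filterS.
  apply: filterS2 bad0 fin_time => w nbad ft.
  have [K nK] : exists K, ~ bad K w.
    by apply/existsNP => h; apply: nbad => K _; exact: h.
  apply: (free_path (budget := bud) (reserve := growth_reserve (beta := beta))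
    _ _ ft (K := K) (j := bud K)).
  - exact: growth_reserve_ge0.
  - exact: growth_reserve_step.
  - by move=> n sn; apply: nK; exists n.
(* The vertices are countable, so one null set serves the tails of all geodesics at once. *)
have : {ae P, forall w y, y <> [::] -> reduced y ->
    limn_einf (fun n => discounted_flow (beta := beta) Pi n y w) < +oo}.
  apply: ae_forall_countable => y.
  have [y0|y0] := eqVneq y [::]; first by apply: aeW => w /(_ y0).
  have [ry|ry] := boolP (reduced y); last by apply: aeW.
  have := discounted_flow_bounded hbeta2 hmu hPi (elimN eqP y0) ry.
  by apply: filterS.
apply: filterS => w bounded x gx; apply/eqP; rewrite -leye_eq leNgt; apply/negP => toty.
have [m fm] := discounted_flow_cvgy hbeta2 gx toty.
have rx : reduced (x m.+1) by case: gx => _ [rx _]; exact: rx.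
have := bounded _ (root_geodesic_neq0 (n := m) gx) rx.
by rewrite is_cvg_limn_einfE ?(cvg_lim _ fm)//; apply/cvg_ex; exists +oo.
Qed.
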